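(* Let $\mathbb{G}$ be a Carnot group with horizontal layer of dimension $m_1$. Suppose $u:\Omega\times[0,T)\to\mathbb{R}$, where $\Omega\subset\mathbb{G}$ is bounded, is a smooth solution to $$\begin{cases}u_t=\dfrac{\det_+\big((D_0^2u)^*\big)}{\big(\sqrt{1+|D_0u|^2}\big)^{m_1+1}},\\[2mm] u(x,0)=u_0(x)\ \text{ on }\overline\Omega,\\ u(x,t)=g(x,t)\ \text{ on }\partial\Omega\times[0,T),\end{cases}$$ where $g(x,t)$ is such that $g_t(x,t)\ge\delta>0$ for all $(x,t)\in\partial\Omega\times[0,T)$ and $u_0(x)$ is strictly weakly H-convex. Then $u(x,t)$ is strictly weakly H-convex (as a function of $x\in\Omega$) for each fixed $t\ge 0$ (that is, for each $t\in[0,T)$).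
   Context: Carnot group: a simply connected Lie group $\mathbb{G}$ whose Lie algebra has a stratification $\mathfrak{g}=V^1\oplus\cdots\oplus V^r$ with $[V^1,V^j]=V^{j+1}$ for $1\le j\le r-1$ and $[V^j,V^r]=0$ for $1\le j\le r$, equipped with the associated Carnot-Carathéodory metric; $m_1=\dim V^1$. Fix a left-invariant basis $X_1,\dots,X_{m_1}$ of $V^1$, orthonormal for a fixed inner product on $\mathfrak{g}$ for which the $V^j$ are mutually orthogonal. Derivatives (in the space variable): $D_0u=(X_iu)_{1\le i\le m_1}$ is the horizontal gradient, $D_0^2u=(X_iX_ju)_{1\le i,j\le m_1}$, and $(D_0^2u)^*=\frac12(D_0^2u+(D_0^2u)^T)$ is the symmetrized horizontal Hessian. For a real symmetric $m_1\times m_1$ matrix $X$ with eigenvalues $\lambda_1,\dots,\lambda_{m_1}$, $\det_+X=\prod_{i=1}^{m_1}\max\{\lambda_i,0\}$. Strict weak H-convexity: a smooth function $w$ is strictly weakly H-convex if and only if the symmetrized horizontal second fundamental form of its graph $\{(x,s):w(x)-s=0\}$ in the Carnot group $\mathbb{G}\times\mathbb{R}$ (the vector field $\partial/\partial s$ being added to the first layer) is positive definite; equivalently, if and only if the matrix $(D_0^2w)^*$ is positive definite at each point. *)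

(* Defs.v *)
From HB Require Import structures.
From mathcomp Require Import all_boot all_order all_algebra.
From mathcomp Require Import all_classical all_reals all_analysis.

Set Implicit Arguments.
Unset Strict Implicit.
Unset Printing Implicit Defensive.

Import Order.TTheory GRing.Theory Num.Theory.
Import numFieldNormedType.Exports.

Local Open Scope classical_set_scope.
Local Open Scope ring_scope.

Section Calculus.
Context {R : realType}.

(* One-sided at the endpoints of I. *)
Definition has_deriv_in {V : normedModType R} (I : set R) (f : R -> V)
    (t : R) (l : V) : Prop :=
  (fun h => h^-1 *: (f (t + h) - f t)) @ within [set h | I (t + h)] 0^' --> l.

(* For finite-dimensional V and open A, the conjunction over all k says that f
   is C^oo on A: a function all of whose iterated directional derivatives are
   differentiable has continuous ones. *)
Fixpoint diff_n {V : normedModType R} (k : nat) (A : set V) (f : V -> R)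
    : Prop :=
  if k is k'.+1 then
    (forall p, A p -> differentiable f p) /\
    (forall v, diff_n k' A (fun p => 'D_v f p))
  else True.

(* Smoothness on an arbitrary set: local existence of smooth extensions. *)
Definition smooth_on {V : normedModType R} (S : set V) (f : V -> R) : Prop :=
  forall p, S p -> exists (W : set V) (F : V -> R),
    [/\ open W, W p, (forall k, diff_n k W F)
      & forall q, S q -> W q -> F q = f q].

Definition simply_connected (T : topologicalType) : Prop :=
  (forall x y : T, exists c : R -> T,
     [/\ {within `[0, 1], continuous c}, c 0 = x & c 1 = y]) /\
  (forall c : R -> T, {within `[0, 1], continuous c} -> c 0 = c 1 ->
     exists H : R * R -> T,
       [/\ {within `[0, 1] `*` `[0, 1], continuous H},
           {in `[0, 1], forall s, H (s, 0) = c s},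
           {in `[0, 1], forall s, H (s, 1) = c 0}
         & {in `[0, 1], forall t, H (0, t) = c 0 /\ H (1, t) = c 0}]).

End Calculus.

#[short(type="topGroupType")]
HB.structure Definition TopGroup := {G of Group G & Topological G}.

Record chart (R : realType) (n : nat) (T : topologicalType) := Chart {
  cdom : set T;
  cfwd : T -> 'rV[R]_n;
  cbwd : 'rV[R]_n -> T;
  cdom_open : open cdom;
  cimg_open : open (cfwd @` cdom);
  cfwdK : forall x, cdom x -> cbwd (cfwd x) = x;
  cfwd_continuous : {within cdom, continuous cfwd};
  cbwd_continuous : {within cfwd @` cdom, continuous cbwd}
}.

Record lieGroup (R : realType) (n : nat) := LieGroup {
  lie_sort :> topGroupType;
  lie_hausdorff : hausdorff_space lie_sort;
  lie_second_countable : @second_countable lie_sort;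
  atlas : set (chart R n lie_sort);
  atlas_cover : forall x, exists2 c, atlas c & cdom c x;
  atlas_compat : forall c d, atlas c -> atlas d -> forall k,
    smooth_on (cfwd c @` (cdom c `&` cdom d))
      (fun y => cfwd d (cbwd c y) 0 k);
  lie_mul_continuous : continuous (fun p : lie_sort * lie_sort => (p.1 * p.2)%g);
  lie_inv_continuous : continuous (fun x : lie_sort => (x^-1)%g);
  lie_mul_smooth : forall c d e, atlas c -> atlas d -> atlas e -> forall k,
    smooth_on [set p : 'rV[R]_n * 'rV[R]_n |
        [/\ (cfwd c @` cdom c) p.1, (cfwd d @` cdom d) p.2
          & cdom e (cbwd c p.1 * cbwd d p.2)%g]]
      (fun p => cfwd e (cbwd c p.1 * cbwd d p.2)%g 0 k);
  lie_inv_smooth : forall c e, atlas c -> atlas e -> forall k,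
    smooth_on [set y | (cfwd c @` cdom c) y /\ cdom e (cbwd c y)^-1%g]
      (fun y => cfwd e (cbwd c y)^-1%g 0 k)
}.

Section LieGroupTheory.
Context {R : realType} {n : nat} {G : lieGroup R n}.

Definition smooth_fun (S : set G) (f : G -> R) : Prop :=
  forall c, atlas c ->
    smooth_on (cfwd c @` (cdom c `&` S)) (fun y => f (cbwd c y)).

Definition smooth_fun_time (S : set G) (I : set R) (u : G -> R -> R) : Prop :=
  forall c, atlas c ->
    smooth_on ((cfwd c @` (cdom c `&` S)) `*` I)
      (fun p : 'rV[R]_n * R => u (cbwd c p.1) p.2).

(* Given a chart c at the unit, v : 'rV_n stands for the tangent vector at the
   unit with coordinates v, that is for an element of the Lie algebra;
   [lder c v] is the corresponding left-invariant vector field, acting on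
   functions as a derivation. *)
Definition lder (c : chart R n G) (v : 'rV[R]_n) (f : G -> R) (x : G) : R :=
  'D_v (fun y => f (x * cbwd c y)%g) (cfwd c 1%g).

(* The components at the unit of the commutator of left-invariant fields,
   obtained by applying it to the coordinate functions of c. *)
Definition lie_bracket (c : chart R n G) (v w : 'rV[R]_n) : 'rV[R]_n :=
  \row_k (lder c v (lder c w (fun x => cfwd c x 0 k)) 1%g
          - lder c w (lder c v (fun x => cfwd c x 0 k)) 1%g).

End LieGroupTheory.

(* n is the topological dimension, m1 the dimension of the first layer; layers
   are indexed from 1 to the step. *)
Record carnotGroup (R : realType) (n m1 : nat) := CarnotGroup {
  carnot_sort :> lieGroup R n;
  carnot_simply_connected : @simply_connected R carnot_sort;
  chart1 : chart R n carnot_sort;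
  chart1_atlas : atlas chart1;
  chart1_dom : cdom chart1 1%g;
  step : nat;
  layer : nat -> {vspace 'rV[R]_n};
  step_gt0 : (0 < step)%N;
  layer_sum : (\sum_(1 <= j < step.+1) layer j)%VS = fullv;
  layer_direct : directv (\sum_(1 <= j < step.+1) layer j);
  (* layer j.+1 is the span of the brackets [v, w], v in V^1, w in V^j *)
  layer_bracket : forall j, (1 <= j < step)%N -> forall U : {vspace 'rV[R]_n},
    (layer j.+1 <= U)%VS <->
    (forall v w, v \in layer 1 -> w \in layer j ->
       lie_bracket chart1 v w \in U);
  layer_last : forall j, (1 <= j <= step)%N -> forall v w,
    v \in layer j -> w \in layer step -> lie_bracket chart1 v w = 0;
  inner : {dot 'rV[R]_n for idfun};
  layer_orthogonal : forall i j, (1 <= i <= step)%N -> (1 <= j <= step)%N ->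
    i != j -> forall v w, v \in layer i -> w \in layer j -> inner v w = 0;
  frame : m1.-tuple 'rV[R]_n;
  frame_basis : basis_of (layer 1) frame;
  frame_orthonormal : forall i j : 'I_m1,
    inner (tnth frame i) (tnth frame j) = (i == j)%:R
}.

Section CarnotGroupTheory.
Context {R : realType} {n m1 : nat} {G : carnotGroup R n m1}.

(* gam is a C^1 horizontal curve on [0, 1] and a t is its velocity gam'(t)
   translated back to the unit. *)
Definition horizontal_curve (gam : R -> G) (a : R -> 'rV[R]_n) : Prop :=
  [/\ {within `[0, 1], continuous gam}, {within `[0, 1], continuous a}
    & forall t, t \in `[0, 1] -> a t \in layer G 1 /\
        has_deriv_in `[0, 1] (fun s => cfwd (chart1 G) ((gam t)^-1 * gam s)%g)
          t (a t)].

(* Carnot-Caratheodory distance. The speed of a curve may vanish, so C^1 curves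
   give the same infimum as piecewise C^1 ones. *)
Definition cc_dist (x y : G) : \bar R :=
  ereal_inf [set l | exists gam a,
    [/\ horizontal_curve gam a, gam 0 = x, gam 1 = y &
        l = (\int[lebesgue_measure]_(t in `[0%R, 1%R])
               (Num.sqrt (inner G (a t) (a t)))%:E)%E]].

Definition cc_bounded (S : set G) : Prop :=
  exists (x : G) (r : R), S `<=` [set y | (cc_dist x y < r%:E)%E].

Definition hder (i : 'I_m1) (f : G -> R) : G -> R :=
  lder (chart1 G) (tnth (frame G) i) f.

Definition hgrad (f : G -> R) (x : G) : 'rV[R]_m1 := \row_i hder i f x.

Definition hhess (f : G -> R) (x : G) : 'M[R]_m1 :=
  \matrix_(i, j) hder i (hder j f) x.

Definition sym_hhess (f : G -> R) (x : G) : 'M[R]_m1 :=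
  2^-1 *: (hhess f x + (hhess f x)^T).

End CarnotGroupTheory.

Section SymmetricMatrices.
Context {R : realType} {m : nat}.

(* The eigenvalues with multiplicity, as the roots of the characteristic
   polynomial, which splits over R when X is symmetric. Their order is
   irrelevant; the value is 0 if char_poly X does not split. *)
Definition eigenvalues (X : 'M[R]_m) : 'rV[R]_m :=
  xget (0 : 'rV[R]_m)
    [set l : 'rV[R]_m | char_poly X = \prod_(i < m) ('X - (l 0 i)%:P)].

Definition det_plus (X : 'M[R]_m) : R :=
  \prod_(i < m) Num.max (eigenvalues X 0 i) 0.

Definition pos_def (X : 'M[R]_m) : Prop :=
  forall v : 'rV[R]_m, v != 0 -> 0 < (v *m X *m v^T) 0 0.

Definition sqr_norm (v : 'rV[R]_m) : R := \sum_(i < m) v 0 i ^+ 2.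

End SymmetricMatrices.

Section Flow.
Context {R : realType} {n m1 : nat} {G : carnotGroup R n m1}.

(* S need not be open: derivatives at a point of S are those of a smooth
   extension to a neighbourhood of that point. They do not depend on the
   extension when S is contained in the closure of its interior. *)
Definition strictly_weakly_Hconvex (S : set G) (f : G -> R) : Prop :=
  forall x, S x -> exists (W : set G) (w : G -> R),
    [/\ open W, W x, smooth_fun W w, (forall y, S y -> W y -> w y = f y)
      & pos_def (sym_hhess w x)].

Definition time_interval (T : \bar R) : set R :=
  [set t | 0 <= t /\ (t%:E < T)%E].

(* At t = 0 the time derivative is the right derivative. *)
Definition smooth_flow_solution (Omega : set G) (T : \bar R)
    (u0 : G -> R) (g u : G -> R -> R) : Prop :=
  [/\ smooth_fun_time Omega (time_interval T) u,
      {within closure Omega `*` time_interval T,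
         continuous (fun p : G * R => u p.1 p.2)},
      (forall x t, Omega x -> time_interval T t ->
         has_deriv_in (time_interval T) (u x : R -> R^o) t
           (det_plus (sym_hhess (u ^~ t) x)
            / Num.sqrt (1 + sqr_norm (hgrad (u ^~ t) x)) ^+ m1.+1)),
      (forall x, closure Omega x -> u x 0 = u0 x)
    & forall x t, (closure Omega `\` Omega) x -> time_interval T t ->
        u x t = g x t].

End Flow.

(* Main.v *)
(** The flow is invariant under time translation and under adding constants, so
    it is compared with its own translates.  Let Phi (x, s, t) be
    u x t - u x s - c (t - s) + eps t on closure Omega and 0 <= s <= t <= t1.
    At a negative minimum x cannot lie on the boundary, where u grows at rate
    delta >= c, and s < t.  At an interior minimum the horizontal gradients of
    u^~ s and u^~ t agree and their symmetrized Hessians are ordered, so that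
    u_t (x, s) <= u_t (x, t), because det_+ is monotone; the first-order
    conditions in s and t, together with u_t >= c at time 0, give
    u_t (x, s) >= c and u_t (x, t) <= c - eps, a contradiction.  Hence
    u_t >= c > 0 everywhere, that is det_+ > 0, which forces all eigenvalues to
    be positive.

    Minima exist because closure Omega is compact: in a chart around the unit
    the multiplication is Lipschitz, so a short horizontal curve starting at the
    unit stays in a compact ball K, and every Carnot-Caratheodory ball around x
    lies in x K^N for some N. *)
Require Import Defs.
From mathcomp Require Import all_boot all_order all_algebra.
From mathcomp Require Import all_classical all_reals all_analysis.
From mathcomp Require Import complex ring lra.

Set Implicit Arguments.
Unset Strict Implicit.
Unset Printing Implicit Defensive.

Import Order.TTheory GRing.Theory Num.Theory.
Import numFieldNormedType.Exports.

Local Open Scope classical_set_scope.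
Local Open Scope ring_scope.

(** * Symmetric matrices *)

(** The natural argument, a maximum principle for u_t, would differentiate the equation in time; but
    det_+ is in general not differentiable at a matrix with a zero eigenvalue, precisely the
    degeneration to be excluded. Comparing values of u at two times uses nothing of det_+ but its
    monotonicity.

    The two times vary independently. With a fixed shift tau the comparison would have to start from
    u(x, tau) - u(x, 0) >= c tau, an estimate of the very kind sought; with s and t free, the only
    information needed at time 0 is the speed of the initial datum.

    On the boundary u is merely continuous, so minima there are excluded by increments of g, never
    by derivatives of u. The term eps t makes the first-order condition in t strict; its cost is
    removed at the end by letting eps tend to 0. *)

Lemma real_complex_real (R : rcfType) (x : R) : real_complex R x \is Num.real.
Proof. by rewrite complex_real. Qed.

Lemma char_poly_conj (F : fieldType) m (P B : 'M[F]_m) : P \in unitmx ->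
  char_poly (invmx P *m B *m P) = char_poly B.
Proof.
move=> Pu; rewrite /char_poly /char_poly_mx !map_mxM.
have -> : 'X%:M - map_mx polyC (invmx P) *m map_mx polyC B *m map_mx polyC P =
  map_mx polyC (invmx P) *m ('X%:M - map_mx polyC B) *m map_mx polyC P.
  rewrite mulmxBr mulmxBl; congr (_ - _).
  by rewrite scalar_mxC -mulmxA -map_mxM mulVmx// map_mx1 mulmx1.
rewrite !det_mulmx !det_map_mx mulrAC -polyCM det_inv mulVr ?mul1r//.
Qed.

(** Obtained from the unitary diagonalization of A seen as a complex Hermitian matrix. The complex
    eigenbasis stays hidden: w_i is the squared modulus of the i-th coordinate of v in it. *)
Lemma symmetric_spectral (R : rcfType) m (A : 'M[R]_m) : A^T = A ->
  exists r : 'rV[R]_m, char_poly A = \prod_(i < m) ('X - (r 0 i)%:P) /\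
    forall v : 'rV[R]_m, exists w : 'rV[R]_m,
      [/\ forall i, 0 <= w 0 i,
         \sum_i w 0 i = (v *m v^T) 0 0
       & (v *m A *m v^T) 0 0 = \sum_i r 0 i * w 0 i].
Proof.
move=> symA.
pose toC := real_complex R.
pose Ac : 'M[R[i]]_m := map_mx toC A.
have hAc : Ac \is hermsymmx.
  apply: realsym_hermsym.
    by apply/is_hermitianmxP; rewrite expr0 scale1r map_mx_id// /Ac map_trmx symA.
  by apply/mxOverP => i j; rewrite mxE real_complex_real.
have /orthomx_spectralP AcE := hermitian_normalmx hAc.
have dreal := hermitian_spectral_diag_real hAc.
have Pun := spectral_unitarymx Ac.
set P := spectralmx Ac in AcE Pun; set d := spectral_diag Ac in AcE dreal.
have Pu : P \in unitmx by exact: unitarymx_unit.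
pose r : 'rV[R]_m := map_mx (@complex.Re R) d.
have dE i : d 0 i = toC (r 0 i).
  rewrite mxE /toC; have /mxOverP/(_ 0 i) := dreal.
  by case: (d 0 i) => a b; rewrite complex_real/= => /eqP ->.
exists r; split.
  apply: (map_poly_inj (real_complex R)).
  rewrite map_char_poly -/Ac AcE char_poly_conj// char_poly_trig ?diag_mx_is_trig//.
  rewrite rmorph_prod; apply: eq_bigr => i _ /=.
  by rewrite rmorphB /= map_polyX map_polyC /= !mxE eqxx mulr1n dE mxE.
move=> v; pose vc : 'rV[R[i]]_m := map_mx toC v.
(* Coordinates of v in the eigenbasis. As v is real, the conjugate transpose of z is [P *m vc^T], so
   both forms below become sums of squared moduli. *)
have [z zdef] : exists z : 'rV[R[i]]_m, z = vc *m map_mx Num.conj P^T by eexists.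
have zE : map_mx Num.conj z^T = P *m vc^T.
  rewrite zdef trmx_mul map_mxM map_trmx trmxK -map_mx_comp.
  rewrite (map_mx_id (@conjCK _)); congr (_ *m _).
  apply/matrixP => i j; rewrite !mxE; apply/CrealP; exact: real_complex_real.
exists (\row_i complex.Re (`|z 0 i| ^+ 2)).
have nE i : real_complex R (complex.Re (`|z 0 i| ^+ 2)) = z 0 i * (z 0 i)^*.
  rewrite -normCK.
  have : `|z 0 i| ^+ 2 \is Num.real by rewrite rpredX// normr_real.
  by case: (`|z 0 i| ^+ 2) => a b; rewrite complex_real/= => /eqP ->.
split.
- move=> i; rewrite mxE; have : 0 <= `|z 0 i| ^+ 2 by rewrite exprn_ge0.
  by case: (`|z 0 i| ^+ 2) => a b; rewrite lecE/= => /andP[].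
- apply: (@complexI R); rewrite rmorph_sum/=.
  have -> : ((v *m v^T) 0 0)%:C%C = (vc *m vc^T) 0 0.
    by rewrite /vc map_trmx -map_mxM [RHS]mxE.
  have -> : vc *m vc^T = z *m map_mx Num.conj z^T.
    rewrite zE zdef -mulmxA (mulmxA _ P) -(invmx_unitary Pun) mulVmx//.
    by rewrite mul1mx.
  by rewrite mxE; apply: eq_bigr => i _; rewrite !mxE nE.
- apply: (@complexI R); rewrite rmorph_sum/=.
  have -> : ((v *m A *m v^T) 0 0)%:C%C = (vc *m Ac *m vc^T) 0 0.
    by rewrite /vc /Ac map_trmx -!map_mxM [RHS]mxE.
  rewrite {1}AcE !mulmxA (invmx_unitary Pun) -zdef -mulmxA -zE mxE.
  apply: eq_bigr => i _; rewrite mul_mx_diag !mxE rmorphM /= nE dE !mxE.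
  by rewrite mulrAC mulrC.
Qed.

(** * Monotonicity and stability of [det_plus] *)

Section DetPlus.
Context {R : realType}.

Lemma quad_form_tr m (A : 'M[R]_m) (v : 'rV[R]_m) :
  (v *m A^T *m v^T) 0 0 = (v *m A *m v^T) 0 0.
Proof.
have -> : v *m A^T *m v^T = (v *m A *m v^T)^T.
  by rewrite !trmx_mul trmxK mulmxA.
by rewrite mxE.
Qed.

Lemma sqr_normE m (v : 'rV[R]_m) : (v *m v^T) 0 0 = sqr_norm v.
Proof.
by rewrite mxE; apply: eq_bigr => i _; rewrite mxE expr2.
Qed.

Lemma sqr_norm_gt0 m (v : 'rV[R]_m) : v != 0 -> 0 < sqr_norm v.
Proof.
move=> v0; rewrite lt_def sumr_ge0 ?andbT => [|i _]; last exact: sqr_ge0.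
apply: contra v0 => /eqP /psumr_eq0P v0.
apply/eqP/rowP => i; rewrite mxE; apply/eqP.
by rewrite -sqrf_eq0 v0// => j _; exact: sqr_ge0.
Qed.

Lemma eigenvaluesE m (A : 'M[R]_m) : A^T = A ->
  char_poly A = \prod_(i < m) ('X - (eigenvalues A 0 i)%:P).
Proof.
move=> /symmetric_spectral[r [rE _]]; rewrite /eigenvalues.
by case: xgetP => [l _ lE//|/(_ r)].
Qed.

Lemma det_plus_ge0 m (A : 'M[R]_m) : 0 <= det_plus A.
Proof. by apply: prodr_ge0 => i _; rewrite le_max lexx orbT. Qed.

Lemma det_plus_gt0_pos_def m (A : 'M[R]_m) : A^T = A ->
  0 < det_plus A -> pos_def A.
Proof.
move=> symA A_gt0 v v0.
have eig_gt0 i : 0 < eigenvalues A 0 i.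
  rewrite ltNge; apply/negP => le0; move: A_gt0.
  by rewrite /det_plus (bigD1 i)//= (max_r le0) mul0r ltxx.
have [r [rE /(_ v)[w [w_ge0 wv ->]]]] := symmetric_spectral symA.
(* The spectral lemma brings its own list r of roots, not the chosen [eigenvalues A]; both factor
   the same characteristic polynomial, so each r_i occurs among the positive eigenvalues. *)
have r_gt0 i : 0 < r 0 i.
  have : (char_poly A).[r 0 i] = 0.
    by rewrite rE horner_prod (bigD1 i)//= hornerXsubC subrr mul0r.
  rewrite eigenvaluesE// horner_prod => /eqP/prodf_eq0[j _].
  by rewrite hornerXsubC subr_eq0 => /eqP ->.
rewrite lt_def sumr_ge0 ?andbT => [|i _]; last by rewrite mulr_ge0// ltW.
apply/eqP => /psumr_eq0P rw0.
have : 0 < \sum_i w 0 i by rewrite wv sqr_normE sqr_norm_gt0.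
rewrite big1 ?ltxx// => i _.
have := rw0 (fun i _ => mulr_ge0 (ltW (r_gt0 i)) (w_ge0 i)) i isT.
by move/eqP; rewrite mulf_eq0 gt_eqF//= => /eqP.
Qed.

Lemma pos_def_eigenvalue_gt0 m (A : 'M[R]_m) (r : R) : pos_def A ->
  eigenvalue A r -> 0 < r.
Proof.
move=> pA /eigenvalueP[v vA v0]; have := pA v v0.
by rewrite vA -scalemxAl mxE sqr_normE pmulr_lgt0// sqr_norm_gt0.
Qed.

Lemma pos_def_det_plus m (A : 'M[R]_m) : A^T = A -> pos_def A ->
  det_plus A = \det A.
Proof.
move=> symA pA.
have eig_gt0 i : 0 < eigenvalues A 0 i.
  apply: pos_def_eigenvalue_gt0 pA _.
  rewrite eigenvalue_root_char; apply/rootP.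
  by rewrite {1}eigenvaluesE// horner_prod (bigD1 i)//= hornerXsubC subrr mul0r.
(* Compare the values at 0 of the characteristic polynomial: both carry the sign (-1)^m, which
   cancels. *)
have := char_poly_det A; rewrite eigenvaluesE// -horner_coef0 horner_prod.
under eq_bigr do rewrite hornerXsubC sub0r.
rewrite prodrN card_ord => /(mulrI (unitrX _ (unitrN1 _))) <-.
by apply: eq_bigr => i _; rewrite max_l// ltW.
Qed.

(* As a quadratic form this is A minimised over the first variable, hence it is
   monotone in A; this gives the monotonicity of the determinant by induction. *)
Definition schur_complement m (A : 'M[R]_(1 + m)) : 'M[R]_m :=
  drsubmx A - (ulsubmx A 0 0)^-1 *: (dlsubmx A *m ursubmx A).

Lemma det_schur m (A : 'M[R]_(1 + m)) : ulsubmx A 0 0 != 0 ->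
  \det A = ulsubmx A 0 0 * \det (schur_complement A).
Proof.
move=> a0.
(* One step of Gaussian elimination: L has determinant 1 and clears the first column below the
   corner. *)
pose L : 'M[R]_(1 + m) :=
  block_mx 1%:M 0 (- (ulsubmx A 0 0)^-1 *: dlsubmx A) 1%:M.
have -> : \det A = \det (L *m A).
  by rewrite det_mulmx det_lblock !det1 !mul1r.
rewrite -[X in \det (L *m X)]submxK /L mulmx_block !mul1mx !mul0mx !addr0.
have -> : - (ulsubmx A 0 0)^-1 *: dlsubmx A *m ulsubmx A + dlsubmx A = 0.
  rewrite [ulsubmx A]mx11_scalar mul_mx_scalar !mxE eqxx mulr1n.
  rewrite scalerA mulrN divff// ?scaleN1r ?addNr//.
  by move: a0; rewrite !mxE.
rewrite det_ublock det_mx11; congr (_ * \det _).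
by rewrite /schur_complement addrC scaleNr mulNmx -scalemxAl.
Qed.

(** Completes the square in t; the value of t that kills the square is the minimiser when the corner
    entry is positive. *)
Lemma quad_form_schur m (A : 'M[R]_(1 + m)) (t : R) (v : 'rV[R]_m) :
  A^T = A -> ulsubmx A 0 0 != 0 ->
  (row_mx t%:M v *m A *m (row_mx t%:M v)^T) 0 0 =
  ulsubmx A 0 0 * (t + (ulsubmx A 0 0)^-1 * (v *m dlsubmx A) 0 0) ^+ 2
  + (v *m schur_complement A *m v^T) 0 0.
Proof.
move=> symA a0.
have ur : ursubmx A = (dlsubmx A)^T by rewrite -{1}symA -trmx_dlsub.
rewrite -{1}[A]submxK mul_row_block tr_row_mx mul_row_col tr_scalar_mx.
rewrite /schur_complement mulmxBr mulmxBl -scalemxAr -scalemxAl ur.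
set a := ulsubmx A in a0 *; set b := dlsubmx A; set D := drsubmx A.
have bv : b^T *m v^T = (v *m b)^T by rewrite trmx_mul.
have -> : v *m (b *m b^T) *m v^T = (v *m b) *m (v *m b)^T.
  by rewrite -bv !mulmxA.
rewrite [a]mx11_scalar mulmxDl mulmxDl -scalar_mxM.
rewrite -(mulmxA _ b^T) bv.
set s := v *m b.
rewrite [s]mx11_scalar tr_scalar_mx -!scalar_mxM.
move: (v *m D *m v^T) (s 0 0) (a 0 0) a0 => q y x x0.
by rewrite !mxE !mulr1n; field.
Qed.

Lemma det_le_pos_def m (A B : 'M[R]_m) : A^T = A -> B^T = B -> pos_def A ->
  (forall v : 'rV[R]_m, (v *m A *m v^T) 0 0 <= (v *m B *m v^T) 0 0) ->
  0 < \det A <= \det B.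
Proof.
elim: m A B => [|m IH] A B symA symB pA leAB; first by rewrite !det_mx00 ltr01 lexx.
rewrite -[m.+1]/(1 + m)%N in A B symA symB pA leAB *.
have quadul (C : 'M[R]_(1 + m)) :
    (row_mx 1%:M 0 *m C *m (row_mx 1%:M 0)^T) 0 0 = ulsubmx C 0 0.
  rewrite -{1}[C]submxK mul_row_block tr_row_mx mul_row_col.
  by rewrite !mul0mx trmx0 mulmx0 !addr0 mul1mx trmx1 mulmx1.
have a_gt0 : 0 < ulsubmx A 0 0.
  rewrite -quadul; apply: pA; apply/eqP => /(congr1 lsubmx).
  rewrite row_mxKl => /matrixP/(_ 0 0)/eqP.
  by rewrite !mxE oner_eq0.
have ab : ulsubmx A 0 0 <= ulsubmx B 0 0 by rewrite -!quadul.
have b_gt0 : 0 < ulsubmx B 0 0 by exact: lt_le_trans ab.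
have symS (C : 'M[R]_(1 + m)) : C^T = C ->
    (schur_complement C)^T = schur_complement C.
  move=> symC; rewrite /schur_complement linearB linearZ/= trmx_mul.
  by rewrite trmx_drsub trmx_dlsub trmx_ursub symC.
have quadS (C : 'M[R]_(1 + m)) v : C^T = C -> ulsubmx C 0 0 != 0 ->
    (v *m schur_complement C *m v^T) 0 0 =
    (row_mx (- ((ulsubmx C 0 0)^-1 * (v *m dlsubmx C) 0 0))%:M v *m C *m
     (row_mx (- ((ulsubmx C 0 0)^-1 * (v *m dlsubmx C) 0 0))%:M v)^T) 0 0.
  move=> symC c0; rewrite quad_form_schur//.
  by rewrite addNr expr0n mulr0 add0r.
have [] := andP (IH (schur_complement A) (schur_complement B) _ _ _ _).
- exact: symS.
- exact: symS.
- move=> v v0; rewrite (quadS A v symA (lt0r_neq0 a_gt0)); apply: pA.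
  apply: contra v0 => /eqP /(congr1 rsubmx); rewrite row_mxKr => ->.
  by apply/eqP/matrixP => i j; rewrite !mxE.
(* Both forms are evaluated at the minimiser for B: there B gives its Schur complement, while A
   gives its own plus a nonnegative square. *)
- move=> v; rewrite (quadS B v symB (lt0r_neq0 b_gt0)).
  apply: le_trans (leAB _); rewrite quad_form_schur ?gt_eqF//.
  by rewrite lerDr mulr_ge0 ?sqr_ge0 ?ltW.
move=> dA dAB; rewrite !det_schur ?gt_eqF//.
by rewrite mulr_gt0// ler_pM// ltW.
Qed.

(** If det_+ A is 0, nonnegativity of det_+ B suffices. Otherwise A, and with it B, is positive
    definite, and det_+ is the determinant on both. *)
Lemma det_plus_le m (A B : 'M[R]_m) : A^T = A -> B^T = B ->
  (forall v : 'rV[R]_m, (v *m A *m v^T) 0 0 <= (v *m B *m v^T) 0 0) ->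
  det_plus A <= det_plus B.
Proof.
move=> symA symB leAB.
have [A_gt0|/le_trans->//] := ltP 0 (det_plus A); last exact: det_plus_ge0.
have pA := det_plus_gt0_pos_def symA A_gt0.
have pB : pos_def B by move=> v /pA /lt_le_trans; apply.
rewrite !pos_def_det_plus//.
by have /andP[] := det_le_pos_def symA symB pA leAB.
Qed.

Lemma pos_def_ge m (A : 'M[R]_m) : A^T = A -> pos_def A ->
  exists2 r : R, 0 < r & forall v : 'rV[R]_m, r * sqr_norm v <= (v *m A *m v^T) 0 0.
Proof.
move=> symA pA; have [r [rE rP]] := symmetric_spectral symA.
have r_gt0 i : 0 < r 0 i.
  apply: pos_def_eigenvalue_gt0 pA _; rewrite eigenvalue_root_char.
  by apply/rootP; rewrite rE horner_prod (bigD1 i)//= hornerXsubC subrr mul0r.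
(* The least eigenvalue; the 1 that starts the minimum keeps the constant meaningful for m = 0. *)
exists (\big[Num.min/1]_(i < m) r 0 i); first by apply: lt_bigmin => // i _.
move=> v; have [w [w_ge0 wv ->]] := rP v.
rewrite -sqr_normE -wv mulr_sumr; apply: ler_sum => i _.
by apply: ler_wpM2r => //; exact: bigmin_le.
Qed.

Lemma quad_formE m (A : 'M[R]_m) (v : 'rV[R]_m) :
  (v *m A *m v^T) 0 0 = \sum_i \sum_j v 0 i * (v 0 j * A i j).
Proof.
rewrite mxE exchange_big/=; apply: eq_bigr => j _; rewrite !mxE mulr_suml.
by apply: eq_bigr => i _; ring.
Qed.

Lemma quad_formB m (A B : 'M[R]_m) (v : 'rV[R]_m) :
  (v *m (A - B) *m v^T) 0 0 = (v *m A *m v^T) 0 0 - (v *m B *m v^T) 0 0.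
Proof.
rewrite mulmxBr mulmxBl.
by move: (v *m A *m _) (v *m B *m _) => a b; rewrite !mxE.
Qed.

Lemma quad_form_small m (A : 'M[R]_m) (e : R) (v : 'rV[R]_m) :
  (forall i j, `|A i j| <= e) ->
  `|(v *m A *m v^T) 0 0| <= e * m%:R * sqr_norm v.
Proof.
move=> Ae; rewrite quad_formE.
have -> : e * m%:R * sqr_norm v =
    \sum_i \sum_j e * (2^-1 * (v 0 i ^+ 2 + v 0 j ^+ 2)).
  have sumc (c : R) : \sum_(j < m) c = m%:R * c.
    by rewrite sumr_const card_ord mulr_natl.
  transitivity (\sum_i (e * 2^-1 * (m%:R * v 0 i ^+ 2 + sqr_norm v))).
    by rewrite -mulr_sumr big_split/= -mulr_sumr sumc -/(sqr_norm v); field.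
  apply: eq_bigr => i _; rewrite -mulr_sumr -mulr_sumr big_split/= sumc.
  by rewrite -/(sqr_norm v) mulrA.
apply: le_trans (ler_norm_sum _ _ _) _; apply: ler_sum => i _.
apply: le_trans (ler_norm_sum _ _ _) _; apply: ler_sum => j _.
rewrite mulrA normrM mulrC; apply: ler_pM => //.
rewrite normrM; have : 0 <= (`|v 0 i| - `|v 0 j|) ^+ 2 by exact: sqr_ge0.
rewrite sqrrB !real_normK ?num_real//; lra.
Qed.

(** Plays the part of continuity of det_+ at A: a symmetric B close to A dominates a positive scalar
    matrix as a quadratic form, and monotonicity concludes. *)
Lemma pos_def_stable m (A : 'M[R]_m) : A^T = A -> pos_def A ->
  exists2 e : R, 0 < e & exists2 c : R, 0 < c &
    forall B : 'M[R]_m, B^T = B -> (forall i j, `|B i j - A i j| <= e) ->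
      c <= det_plus B.
Proof.
move=> symA pA; have [r r0 rA] := pos_def_ge symA pA.
have m1 : 0 < m%:R + 1 :> R by rewrite ltr_wpDl.
(* Entries of size e perturb the form by at most [e * m%:R * sqr_norm v], here at most half of the
   lower bound r; the + 1 guards against m = 0. *)
exists (r / 2 / (m%:R + 1)); first by rewrite !divr_gt0.
have psc : pos_def ((r / 2)%:M : 'M[R]_m).
  move=> v v0; rewrite mul_mx_scalar -scalemxAl mxE sqr_normE.
  by rewrite mulr_gt0 ?divr_gt0 ?sqr_norm_gt0.
exists (det_plus ((r / 2)%:M : 'M[R]_m)).
  by rewrite pos_def_det_plus ?tr_scalar_mx// det_scalar exprn_gt0// divr_gt0.
move=> B symB BA; apply: det_plus_le; rewrite ?tr_scalar_mx// => v.
rewrite mul_mx_scalar -scalemxAl mxE sqr_normE.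
have -> : B = A + (B - A) by rewrite addrC subrK.
rewrite mulmxDr mulmxDl [leRHS]mxE.
have : `|(v *m (B - A) *m v^T) 0 0| <= r / 2 * sqr_norm v.
  apply: le_trans (quad_form_small (e := r / 2 / (m%:R + 1)) _ _) _.
    by move=> i j; rewrite !mxE.
  apply: ler_wpM2r; first by apply: sumr_ge0 => i _; exact: sqr_ge0.
  by rewrite mulrAC ler_pdivrMr// ler_pM2l ?divr_gt0// lerDl.
rewrite ler_norml => /andP[+ _]; have := rA v.
move: (sqr_norm v) (_ 0 0) (_ 0 0) => x y z; lra.
Qed.

End DetPlus.

(** * Iterated directional derivatives *)

Section DiffN.
Context {R : realType}.

Lemma near_pos_ball (V : normedModType R) (a : V) (P : V -> Prop) :
  (\forall x \near a, P x) -> exists2 e : R, 0 < e & forall x, `|x - a| < e -> P x.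
Proof.
move=> /nbhs_normP[e /= e0 eP]; exists e => // x xa; apply: eP.
by rewrite /ball_/= distrC.
Qed.

Lemma continuous_near_le (T : topologicalType) (h : T -> R) x (e : R) :
  {for x, continuous h} -> 0 < e -> \forall y \near x, `|h y - h x| <= e.
Proof.
by move=> /cvgrPdist_le hx /hx; apply: filterS => y; rewrite distrC.
Qed.

Lemma cvg_sum_ord (T : Type) (F : set_system T) (FF : Filter F) n
    (f : 'I_n -> T -> R) (l : 'I_n -> R) : (forall i, f i @ F --> l i) ->
  (fun x => \sum_(i < n) f i x) @ F --> \sum_(i < n) l i.
Proof.
elim: n f l => [|n IH] f l fl.
  by under eq_cvg do rewrite big_ord0; rewrite big_ord0; exact: cvg_cst.
under eq_cvg do rewrite big_ord_recr; rewrite big_ord_recr.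
by apply: cvgD => //; apply: IH => i; exact: fl.
Qed.

Lemma smaller_pos (e e' : R) : 0 < e -> 0 < e' ->
  exists s, [/\ 0 < s, s < e & s < e'].
Proof.
move=> e0 e'0; case: (leP e e') => ee'; first by exists (e / 2); split; lra.
by exists (e' / 2); split; lra.
Qed.

Lemma near_eq_differentiable (V W : normedModType R) (f g : V -> W) (a : V) :
  (\near a, f a = g a) -> differentiable f a -> differentiable g a.
Proof.
move=> fg df.
have fga : f a = g a by exact: nbhs_singleton fg.
have dfc : continuous ('d f a : V -> W) by exact: diff_continuous df.
have dg : g \o shift a = cst (g a) + 'd f a +o_ 0 id.
  apply/eqaddoP => e e0.
  have /diff_locally/eqaddoP/(_ e e0) := df.
  have := fg; rewrite (near_shift 0) => fg0.
  apply: filterS2 fg0 => h /=; rewrite subr0 => fgh.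
  by rewrite !fctE /= fgh fga.
by apply/diff_locallyP; rewrite (diff_unique dfc dg).
Qed.

Lemma derive_sum_coord n (f : 'rV[R]_n -> R) p v : differentiable f p ->
  'D_v f p = \sum_(k < n) v 0 k * 'D_(delta_mx 0 k) f p.
Proof.
move=> df; rewrite deriveE// {1}[v]row_sum_delta linear_sum/=.
by apply: eq_bigr => k _; rewrite linearZ/= deriveE.
Qed.

Lemma derive_slice (V W : normedModType R) (f : V * W -> R) (w : W) (p v : V) :
  'D_v (fun p => f (p, w)) p = 'D_(v, 0) f (p, w).
Proof.
apply: (congr1 (fun g : R -> R => lim (g @ 0^'))); apply/funext => h /=.
rewrite -[h *: (v, 0 : W)]/(h *: v, h *: 0) scaler0.
by rewrite -[(h *: v, 0) + (p, w)]/(h *: v + p, 0 + w) add0r.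
Qed.

Lemma differentiable_slice (V W : normedModType R) (f : V * W -> R) w p :
  differentiable f (p, w) -> differentiable (fun p => f (p, w)) p.
Proof.
move=> df.
apply: (@differentiable_comp _ V (V * W)%type _ (fun q => (q, w)) f) => //.
Qed.

Lemma diff_n_le (V : normedModType R) k (A B : set V) f :
  B `<=` A -> diff_n k A f -> diff_n k B f.
Proof.
move=> BA; elim: k f => //= k IH f [df dvf]; split=> [p /BA|v]; first exact: df.
exact: IH.
Qed.

Lemma diff_nW (V : normedModType R) k (A : set V) f :
  diff_n k.+1 A f -> diff_n k A f.
Proof.
elim: k f => //= k IH f [df dvf]; split=> // v; apply: IH; exact: dvf.
Qed.

Lemma diff_n_ext (V : normedModType R) k (A : set V) f g : open A ->
  {in A, f =1 g} -> diff_n k A f -> diff_n k A g.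
Proof.
move=> oA; elim: k f g => //= k IH f g fg [df dvf].
have nfg p : A p -> \near p, f p = g p.
  move=> Ap; have : nbhs p A by exact: open_nbhs_nbhs.
  by apply: filterS => q Aq; apply: fg; rewrite inE.
split=> [p Ap|v]; first by apply: near_eq_differentiable (nfg p Ap) _; exact: df.
apply: IH (dvf v) => p; rewrite inE => Ap.
exact: near_eq_derive (nfg p Ap).
Qed.

Lemma diff_n_local (V : normedModType R) k (A : set V) f :
  (forall p, A p -> exists W, [/\ open W, W p & diff_n k W f]) -> diff_n k A f.
Proof.
elim: k f => //= k IH f loc; split=> [p Ap|v].
  by have [W [_ Wp [dW _]]] := loc p Ap; exact: dW.
by apply: IH => p Ap; have [W [oW Wp [_ dW]]] := loc p Ap; exists W.
Qed.

Lemma smooth_on_open (V : normedModType R) (S : set V) (f : V -> R) :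
  open S -> smooth_on S f <-> forall k, diff_n k S f.
Proof.
move=> oS; split=> [sf k|df p Sp]; last by exists S, f.
apply: diff_n_local => p Sp; have [W [F [oW Wp dF FE]]] := sf p Sp.
exists (S `&` W); split => //; first exact: openI.
apply: (@diff_n_ext _ _ _ F); first exact: openI.
  by move=> q; rewrite inE => -[]; exact: FE.
by apply: diff_n_le (dF k) => q [].
Qed.

Lemma diff_nD (V : normedModType R) k (A : set V) f g : open A ->
  diff_n k A f -> diff_n k A g -> diff_n k A (fun p => f p + g p).
Proof.
move=> oA; elim: k f g => //= k IH f g [df dvf] [dg dvg]; split=> [p Ap|v].
  by apply: differentiableD; [exact: df|exact: dg].
apply: diff_n_ext (IH _ _ (dvf v) (dvg v)) => // p; rewrite inE => Ap.
by rewrite (deriveD (f := f) (g := g))//; apply: diff_derivable; [exact: df|exact: dg].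
Qed.

Lemma diff_nM (V : normedModType R) k (A : set V) f g : open A ->
  diff_n k A f -> diff_n k A g -> diff_n k A (fun p => f p * g p).
Proof.
move=> oA; elim: k f g => //= k IH f g [df dvf] [dg dvg]; split=> [p Ap|v].
  by apply: differentiableM; [exact: df|exact: dg].
have df' : diff_n k A f by apply: diff_nW; split.
have dg' : diff_n k A g by apply: diff_nW; split.
apply: diff_n_ext (diff_nD oA (IH _ _ df' (dvg v)) (IH _ _ dg' (dvf v))) => //.
move=> p; rewrite inE => Ap.
by rewrite (deriveM (f := f) (g := g))//; apply: diff_derivable; [exact: df|exact: dg].
Qed.

Lemma diff_n_cst (V : normedModType R) k (A : set V) (c : R) :
  diff_n k A (fun=> c).
Proof.
elim: k c => //= k IH c; split=> [p Ap|v]; first exact: differentiable_cst.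
have -> : (fun p => 'D_v (fun=> c) p) = fun=> 0 :> R.
  by apply/funext => p; exact: derive_cst.
exact: IH.
Qed.

Lemma diff_n_sum (V : normedModType R) k (A : set V) n (f : 'I_n -> V -> R) :
  open A -> (forall i, diff_n k A (f i)) ->
  diff_n k A (fun p => \sum_(i < n) f i p).
Proof.
move=> oA; elim: n f => [|n IH] f df.
  have -> : (fun p => \sum_(i < 0) f i p) = fun=> 0.
    by apply/funext => p; rewrite big_ord0.
  exact: diff_n_cst.
have -> : (fun p => \sum_(i < n.+1) f i p) =
    fun p => \sum_(i < n) f (widen_ord (leqnSn n) i) p + f ord_max p.
  by apply/funext => p; rewrite big_ord_recr.
by apply: diff_nD => //; exact: IH.
Qed.

Lemma diff_n_slice (V W : normedModType R) k (A : set (V * W)) f (w : W) :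
  diff_n k A f -> diff_n k [set p | A (p, w)] (fun p => f (p, w)).
Proof.
elim: k f => //= k IH f [df dvf]; split=> [p Ap|v].
  by apply: differentiable_slice; exact: df.
have -> : (fun p => 'D_v (fun q => f (q, w)) p) = fun p => 'D_(v, 0) f (p, w).
  by apply/funext => p; exact: derive_slice.
exact: (IH _ (dvf (v, 0))).
Qed.

Lemma smooth_on_slice (V W : normedModType R) (S : set V) (I : set W) f w :
  I w -> smooth_on (S `*` I) f -> smooth_on S (fun p => f (p, w)).
Proof.
move=> Iw sf p Sp; have [U [F [oU Up dF FE]]] := sf (p, w) (conj Sp Iw).
exists [set p | U (p, w)], (fun p => F (p, w)); split => //.
- apply: open_comp oU => q _; apply: cvg_pair; [exact: cvg_id|exact: cvg_cst].
- by move=> k; exact: diff_n_slice.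
- by move=> q Sq Uq; exact: FE.
Qed.

Lemma derive_slicer (V W : normedModType R) (f : V * W -> R) (p : V) (w v : W) :
  'D_v (fun w => f (p, w)) w = 'D_(0, v) f (p, w).
Proof.
apply: (congr1 (fun g : R -> R => lim (g @ 0^'))); apply/funext => h /=.
rewrite -[h *: (0 : V, v)]/(h *: 0, h *: v) scaler0.
by rewrite -[(0, h *: v) + (p, w)]/(0 + p, h *: v + w) add0r.
Qed.

Lemma differentiable_slicer (V W : normedModType R) (f : V * W -> R) p w :
  differentiable f (p, w) -> differentiable (fun w => f (p, w)) w.
Proof.
move=> df.
apply: (@differentiable_comp _ W (V * W)%type _ (fun q => (p, q)) f) => //.
Qed.

Lemma differentiable_row (V : normedModType R) n (f : V -> 'rV[R]_n) a :
  (forall k, differentiable (fun y => f y 0 k) a) -> differentiable f a.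
Proof.
move=> df.
have -> : f = \sum_(k < n) (fun y => f y 0 k *: (delta_mx 0 k : 'rV[R]_n)).
  apply/funext => y; rewrite fct_sumE; exact: row_sum_delta.
by apply: differentiable_sum => k; apply: differentiableZl.
Qed.

Lemma derive_comp_row (V : normedModType R) n (F : 'rV[R]_n -> R)
    (mu : V -> 'rV[R]_n) a v :
  (forall k, differentiable (fun y => mu y 0 k) a) ->
  differentiable F (mu a) ->
  'D_v (F \o mu) a =
  \sum_(k < n) 'D_v (fun y => mu y 0 k) a * 'D_(delta_mx 0 k) F (mu a).
Proof.
move=> dmu dF; have dmu' := differentiable_row dmu.
rewrite deriveE; last exact: differentiable_comp.
rewrite diff_comp//= -deriveE// derive_sum_coord// -deriveE//.
rewrite derive_mx; last exact: diff_derivable.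
by apply: eq_bigr => k _; rewrite mxE.
Qed.

Lemma diff_nB (V : normedModType R) k (A : set V) f g : open A ->
  diff_n k A f -> diff_n k A g -> diff_n k A (fun p => f p - g p).
Proof.
move=> oA df dg.
have := diff_nD oA df (diff_nM oA (diff_n_cst k A (-1)) dg).
by apply: diff_n_ext => // p _; rewrite mulN1r.
Qed.

Lemma is_derive_line (V : normedModType R) (F : V -> R) p v s :
  derivable F (s *: v + p) v ->
  is_derive s 1 (fun s => F (s *: v + p)) ('D_v F (s *: v + p)).
Proof.
have E : (fun h => h^-1 *: (((fun s => F (s *: v + p)) \o shift s) (h *: 1) -
       F (s *: v + p))) =
     (fun h => h^-1 *: ((F \o shift (s *: v + p)) (h *: v) - F (s *: v + p))).
  apply/funext => h /=; congr (_ *: (F _ - _)).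
  by rewrite [h *: 1]mulr1 scalerDl addrA.
by move=> dF; split; rewrite /derivable /derive E.
Qed.

(** Were l negative, psi would be negative just to the right of 0, and the mean value theorem would
    bring phi below its minimum. Only the value of the second derivative at 0 is involved. *)
Lemma second_derivative_at_min (phi psi : R -> R) (e l : R) : 0 < e ->
  (forall s : R, `|s| < e -> is_derive s 1 phi (psi s)) ->
  (forall s : R, `|s| < e -> phi 0 <= phi s) ->
  is_derive (0 : R) 1 psi l -> psi 0 = 0 /\ 0 <= l.
Proof.
move=> e_gt0 dphi minphi [dpsi_ex dpsiE].
have psi0 : psi 0 = 0.
  have [_ <-] : is_derive (0 : R) 1 phi (psi 0) by apply: dphi; rewrite normr0.
  have [|||t|//] := @derive1_at_min _ phi (- e) e 0.
  - by rewrite (le_trans _ (ltW e_gt0))// oppr_le0 ltW.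
  - by move=> t; rewrite in_itv/= -ltr_norml => /dphi [].
  - by rewrite in_itv/= oppr_lt0 e_gt0.
  - by rewrite in_itv/= -ltr_norml; exact: minphi.
split=> //; rewrite leNgt; apply/negP => neg.
have [e' e'0 psi_lt] : exists2 e' : R, 0 < e' & forall h : R, `|h| < e' ->
    h != 0 -> h^-1 * psi h < 0.
  have : \forall h \near 0^', h^-1 *: ((psi \o shift 0) (h *: 1) - psi 0) < 0.
    apply: (@cvgr_lt _ _ _ _ _ ('D_1 psi 0)); first exact: dpsi_ex.
    by rewrite dpsiE.
  move=> /nbhs_norm0P[e' /= e'0 eP]; exists e' => // h he' h0.
  by have := eP h he' h0; rewrite /= psi0 subr0 addr0 [h *: 1]mulr1.
have [s [s_gt0 se se']] := smaller_pos e_gt0 e'0.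
have dphi_s x : 0 <= x -> x <= s -> is_derive x 1 phi (psi x).
  by move=> x0 xs; apply: dphi; rewrite ger0_norm// (le_lt_trans xs).
have [x xs||c cs] := @MVT _ phi psi 0 s s_gt0.
- by apply: dphi_s; rewrite ltW// (itvP xs).
- apply: derivable_within_continuous => x xs.
  by have [] := dphi_s x _ _; rewrite ?(itvP xs).
apply/eqP; rewrite gt_eqF// subr0.
have c_gt0 : 0 < c by rewrite (itvP cs).
have cn : `|c| < e' by rewrite gtr0_norm// (lt_trans _ se')// (itvP cs).
have := psi_lt c cn (lt0r_neq0 c_gt0).
rewrite pmulr_rlt0 ?invr_gt0// => psic.
apply: (@lt_le_trans _ _ 0); first by rewrite nmulr_rlt0.
by rewrite subr_ge0; apply: minphi; rewrite gtr0_norm.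
Qed.

Lemma derive_at_min (V : normedModType R) (A : set V) (F : V -> R) p v :
  open A -> A p -> diff_n 2 A F ->
  (\forall q \near p, F p <= F q) ->
  'D_v F p = 0 /\ 0 <= 'D_v (fun q => 'D_v F q) p.
Proof.
move=> oA Ap [dF dvF] minF.
have cline : (fun s : R => s *: v + p) @ 0 --> p.
  rewrite -[X in _ --> X]add0r -(scale0r v).
  by apply: cvgD; [apply: cvgZr_tmp; exact: cvg_id|exact: cvg_cst].
have [e e_gt0 eA] : exists2 e : R, 0 < e & forall s, `|s| < e ->
    A (s *: v + p) /\ F p <= F (s *: v + p).
  have : \forall s \near (0 : R), A (s *: v + p) /\ F p <= F (s *: v + p).
    have nA : nbhs p A by exact: open_nbhs_nbhs.
    exact: (cline [set q | A q /\ F p <= F q] (filterI nA minF)).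
  move=> /nbhs_norm0P[e /= e0 eP]; exists e => // s se; exact: eP.
have := @second_derivative_at_min (fun s => F (s *: v + p))
  (fun s => 'D_v F (s *: v + p)) e ('D_v (fun q => 'D_v F q) p) e_gt0.
rewrite scale0r add0r; apply.
- move=> s /eA[As _]; apply: is_derive_line; apply: diff_derivable; exact: dF.
- by move=> s /eA[].
- have := @is_derive_line _ (fun q => 'D_v F q) p v 0.
  rewrite scale0r add0r; apply; apply: diff_derivable.
  by have [] := dvF v => + _; exact.
Qed.

Lemma derive2_sum_coord n (A : set 'rV[R]_n) (F : 'rV[R]_n -> R) p v w :
  open A -> A p -> diff_n 2 A F ->
  'D_w (fun q => 'D_v F q) p = \sum_(l < n) \sum_(k < n) w 0 l * (v 0 k *
    'D_(delta_mx 0 l) (fun q => 'D_(delta_mx 0 k) F q) p).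
Proof.
move=> oA Ap [dF dvF].
have dD u : differentiable (fun q => 'D_u F q) p.
  by have [+ _] := dvF u; apply.
rewrite derive_sum_coord//; apply: eq_bigr => l _.
rewrite -mulr_sumr; congr (_ * _).
rewrite (@near_eq_derive _ _ _ _
  (\sum_(k < n) (v 0 k *: (fun q => 'D_(delta_mx 0 k) F q)))).
  rewrite derive_sum => [|k]; last exact/derivableZ/diff_derivable.
  by apply: eq_bigr => k _; rewrite deriveZ//; exact: diff_derivable.
have nA : nbhs p A by exact: open_nbhs_nbhs.
apply: filterS nA => q Aq; rewrite fct_sumE derive_sum_coord//.
exact: dF.
Qed.

End DiffN.

(** * Left-invariant fields in charts *)

Lemma fst_cvg (T U : topologicalType) (p : T) (q : U) :
  (fun r : T * U => r.1) @ (p, q) --> p.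
Proof. exact: cvg_fst. Qed.

Lemma snd_cvg (T U : topologicalType) (p : T) (q : U) :
  (fun r : T * U => r.2) @ (p, q) --> q.
Proof. exact: cvg_snd. Qed.

Section LieCalculus.
Context {R : realType} {n : nat} {G : lieGroup R n}.
Implicit Types (c d : chart R n G) (D : set G) (f : G -> R).

Lemma mulg_cvg (x y : G) : (fun p : G * G => (p.1 * p.2)%g) @ (x, y) --> (x * y)%g.
Proof. exact: (@lie_mul_continuous _ _ G (x, y)). Qed.

Lemma mulg_continuousr (x : G) : continuous (fun y : G => (x * y)%g).
Proof.
move=> y; apply: (cvg_comp2 (cvg_cst x) cvg_id (h := fun a b => (a * b)%g)).
exact: mulg_cvg.
Qed.

Lemma cbwd_img d p : (cfwd d @` cdom d) p ->
  cdom d (cbwd d p) /\ cfwd d (cbwd d p) = p.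
Proof. by move=> [x dx <-]; rewrite cfwdK. Qed.

Lemma cfwd_cvg d x : cdom d x -> cfwd d @ x --> cfwd d x.
Proof.
move=> dx; have := @cfwd_continuous _ _ _ d.
rewrite continuous_open_subspace; last exact: cdom_open.
by apply; rewrite inE.
Qed.

Lemma cbwd_cvg d p : (cfwd d @` cdom d) p -> cbwd d @ p --> cbwd d p.
Proof.
move=> dp; have := @cbwd_continuous _ _ _ d.
rewrite continuous_open_subspace; last exact: cimg_open.
by apply; rewrite inE.
Qed.

Lemma chart_img_near d D p : open D -> (cfwd d @` (cdom d `&` D)) p ->
  \forall q \near p, (cfwd d @` (cdom d `&` D)) q.
Proof.
move=> oD [x [dx Dx] xp].
have imp : (cfwd d @` cdom d) p by exists x.
have nim : nbhs p (cfwd d @` cdom d).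
  by apply: open_nbhs_nbhs; split => //; exact: cimg_open.
have nD : nbhs p (cbwd d @^-1` D).
  apply: cbwd_cvg => //; apply: open_nbhs_nbhs; split => //.
  by rewrite -xp cfwdK.
apply: filterS2 nim nD => q /cbwd_img[dq qE] Dq.
by exists (cbwd d q).
Qed.

Lemma chart_img_open d D : open D -> open (cfwd d @` (cdom d `&` D)).
Proof.
by move=> oD; rewrite openE => p; exact: chart_img_near.
Qed.

Lemma smooth_fun_diff_n d D f k : atlas d -> open D -> smooth_fun D f ->
  diff_n k (cfwd d @` (cdom d `&` D)) (fun y => f (cbwd d y)).
Proof.
move=> ad oD /(_ d ad) sf.
by have /smooth_on_open := sf; apply; exact: chart_img_open.
Qed.

Lemma diff_n_smooth_fun D f : open D ->
  (forall d k, atlas d ->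
     diff_n k (cfwd d @` (cdom d `&` D)) (fun y => f (cbwd d y))) ->
  smooth_fun D f.
Proof.
move=> oD df d ad; apply/smooth_on_open; first exact: chart_img_open.
by move=> k; exact: df.
Qed.

Lemma smooth_fun_continuous D f x : open D -> smooth_fun D f -> D x ->
  {for x, continuous f}.
Proof.
move=> oD sf Dx.
have [d ad dx] := atlas_cover x.
have /(_ (cfwd d x)) dF := (smooth_fun_diff_n 1 ad oD sf).1.
have cF : {for cfwd d x, continuous (fun y => f (cbwd d y))}.
  by apply: differentiable_continuous; apply: dF; exists x.
have : (fun y => f (cbwd d y)) \o cfwd d @ x --> f (cbwd d (cfwd d x)).
  exact: (cvg_comp _ _ (cfwd_cvg dx) cF).
rewrite cfwdK// => cf; apply: cvg_trans cf; apply: near_eq_cvg.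
have : nbhs x (cdom d) by apply: open_nbhs_nbhs; split=> //; exact: cdom_open.
by apply: filterS => y dy /=; rewrite cfwdK.
Qed.

Lemma smooth_funB D f g : open D -> smooth_fun D f -> smooth_fun D g ->
  smooth_fun D (fun x => f x - g x).
Proof.
move=> oD sf sg; apply: diff_n_smooth_fun => // d k ad.
apply: diff_nB; first exact: chart_img_open.
  exact: smooth_fun_diff_n.
exact: smooth_fun_diff_n.
Qed.

Section Frame.
Variables (c : chart R n G) (ac : atlas c) (c1 : cdom c 1%g).
Let o := cfwd c 1%g.

Lemma unit_coord_img : (cfwd c @` cdom c) o. Proof. by exists 1%g. Qed.

Lemma cbwd_unit_coord : cbwd c o = 1%g. Proof. exact: cfwdK. Qed.

Lemma translate_near (x : G) D : open D -> D x ->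
  \forall y \near o, D (x * cbwd c y)%g.
Proof.
move=> oD Dx.
have := cvg_comp _ _ (cbwd_cvg unit_coord_img) (@mulg_continuousr x (cbwd c o)).
by rewrite cbwd_unit_coord mulg1; apply; exact: open_nbhs_nbhs.
Qed.

Lemma lder_local D f g v x : open D -> (forall y, D y -> f y = g y) -> D x ->
  lder c v f x = lder c v g x.
Proof.
move=> oD fg Dx; apply: near_eq_derive.
by apply: filterS (translate_near oD Dx) => y; exact: fg.
Qed.

(* The product read in the charts d (left factor and result) and c. *)
Definition chart_mul d (q : 'rV[R]_n * 'rV[R]_n) : 'rV[R]_n :=
  cfwd d (cbwd d q.1 * cbwd c q.2)%g.

Definition chart_mul_dom d := [set p : 'rV[R]_n * 'rV[R]_n |
        [/\ (cfwd d @` cdom d) p.1, (cfwd c @` cdom c) p.2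
          & cdom d (cbwd d p.1 * cbwd c p.2)%g]].

Lemma chart_mul_dom_open d : open (chart_mul_dom d).
Proof.
rewrite openE => -[p q] [/= dp cq dpq].
have n1 : nbhs (p, q) [set r | (cfwd d @` cdom d) r.1].
  apply: (@fst_cvg _ _ p q (cfwd d @` cdom d)); apply: open_nbhs_nbhs; split=> //; exact: cimg_open.
have n2 : nbhs (p, q) [set r | (cfwd c @` cdom c) r.2].
  apply: (@snd_cvg _ _ p q (cfwd c @` cdom c)); apply: open_nbhs_nbhs; split=> //; exact: cimg_open.
have n3 : nbhs (p, q) [set r | cdom d (cbwd d r.1 * cbwd c r.2)%g].
  have cf := cvg_comp _ _ (@fst_cvg _ _ p q) (cbwd_cvg dp).
  have cg := cvg_comp _ _ (@snd_cvg _ _ p q) (cbwd_cvg cq).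
  have := cvg_comp _ _ (cvg_pair cf cg) (@mulg_cvg (cbwd d p) (cbwd c q)).
  by apply; apply: open_nbhs_nbhs; split=> //; exact: cdom_open.
by near=> r; split; [near: r; exact: n1|near: r; exact: n2|near: r; exact: n3].
Unshelve. all: by end_near. Qed.

Lemma chart_mul_smooth d k j : atlas d -> diff_n j (chart_mul_dom d) (fun q => chart_mul d q 0 k).
Proof.
move=> ad; have := lie_mul_smooth ad ac ad k.
by move=> /smooth_on_open; apply; exact: chart_mul_dom_open.
Qed.

Lemma chart_mul_dom_unit d p : (cfwd d @` cdom d) p -> chart_mul_dom d (p, o).
Proof.
move=> dp; split=> /=; [exact: dp|exact: unit_coord_img|].
by rewrite cbwd_unit_coord mulg1; have [] := cbwd_img dp.
Qed.

(* The k-th component in the chart d of the left-invariant field v. *)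
Definition frame_coord d (v : 'rV[R]_n) (k : 'I_n) (p : 'rV[R]_n) : R :=
  'D_v (fun y => chart_mul d (p, y) 0 k) o.

(** A left-invariant field is the derivative of the product in its second factor at the unit, so its
    components inherit the joint smoothness of the multiplication. *)
Lemma frame_coord_smooth d v k j : atlas d ->
  diff_n j (cfwd d @` cdom d) (frame_coord d v k).
Proof.
move=> ad; have -> : frame_coord d v k = fun p => 'D_(0, v) (fun q => chart_mul d q 0 k) (p, o).
  by apply/funext => p; exact: derive_slicer.
apply: (@diff_n_le _ _ _ [set p | chart_mul_dom d (p, o)]).
  by move=> p; exact: chart_mul_dom_unit.
have [_ /(_ (0, v))] := chart_mul_smooth k j.+1 ad.
exact: (@diff_n_slice _ _ _ j (chart_mul_dom d) (fun q => 'D_(0, v) (fun q => chart_mul d q 0 k) q) o).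
Qed.

(** Chain rule for f along y -> x y. It turns the derivation into a first-order operator with smooth
    coefficients, from which smoothness, additivity and the second-order expansion follow. *)
Lemma lder_chart d D f v p : atlas d -> open D -> smooth_fun D f ->
  (cfwd d @` (cdom d `&` D)) p ->
  lder c v f (cbwd d p) =
  \sum_(k < n) frame_coord d v k p * 'D_(delta_mx 0 k) (fun y => f (cbwd d y)) p.
Proof.
move=> ad oD sf Pp.
have dp : (cfwd d @` cdom d) p by case: Pp => x [dx _] <-; exists x.
have [dbp fbp] := cbwd_img dp.
have mpo : chart_mul d (p, o) = p by rewrite /chart_mul/= cbwd_unit_coord mulg1.
rewrite /lder -/o (@near_eq_derive _ _ _ _ ((fun y => f (cbwd d y)) \o (fun y => chart_mul d (p, y)))).
  rewrite derive_comp_row ?mpo//.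
    move=> k; apply: (@differentiable_slicer _ _ _ (fun q => chart_mul d q 0 k)).
    by have [+ _] := chart_mul_smooth k 1 ad; apply; exact: chart_mul_dom_unit.
  by have [+ _] := smooth_fun_diff_n 1 ad oD sf; apply.
apply: filterS (translate_near (@cdom_open _ _ _ d) dbp) => y dy /=.
by rewrite /chart_mul/= cfwdK.
Qed.

Lemma lder_smooth D f v : open D -> smooth_fun D f -> smooth_fun D (lder c v f).
Proof.
move=> oD sf; apply: diff_n_smooth_fun => // d k ad.
have oP := @chart_img_open d D oD.
apply: (@diff_n_ext _ _ _ _ (fun p => \sum_(k < n) frame_coord d v k p *
    'D_(delta_mx 0 k) (fun y => f (cbwd d y)) p)) => //.
  by move=> p; rewrite inE => Pp; rewrite (lder_chart _ ad oD sf).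
apply: diff_n_sum => // j; apply: diff_nM => //.
  apply: diff_n_le (frame_coord_smooth v j k ad).
  by move=> _ [x [dx _] <-]; exists x.
by have [_] := smooth_fun_diff_n k.+1 ad oD sf; apply.
Qed.

Lemma lderB D f g v x : open D -> smooth_fun D f -> smooth_fun D g -> D x ->
  lder c v (fun x => f x - g x) x = lder c v f x - lder c v g x.
Proof.
move=> oD sf sg Dx; have [d ad dx] := atlas_cover x.
have Px : (cfwd d @` (cdom d `&` D)) (cfwd d x) by exists x.
have sfg := smooth_funB oD sf sg.
rewrite -(cfwdK dx) (lder_chart _ ad oD sf)// (lder_chart _ ad oD sg)//.
rewrite (lder_chart _ ad oD sfg)// -sumrB; apply: eq_bigr => k _.
rewrite -mulrBr; congr (_ * _).
rewrite (deriveB (f := fun y => f (cbwd d y)) (g := fun y => g (cbwd d y)))//.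
  by apply: diff_derivable; have [+ _] := smooth_fun_diff_n 1 ad oD sf; apply.
by apply: diff_derivable; have [+ _] := smooth_fun_diff_n 1 ad oD sg; apply.
Qed.

(** The terms of first order in f come from differentiating the coefficients; their antisymmetric
    part in v and w is the commutator. At a critical point of f they vanish. *)
Lemma lder2_chart d D f v w p : atlas d -> open D -> smooth_fun D f ->
  (cfwd d @` (cdom d `&` D)) p ->
  lder c v (lder c w f) (cbwd d p) =
  \sum_(l < n) \sum_(k < n) frame_coord d v l p *
    (frame_coord d w k p *
       'D_(delta_mx 0 l) (fun q => 'D_(delta_mx 0 k) (fun y => f (cbwd d y)) q) p
     + 'D_(delta_mx 0 k) (fun y => f (cbwd d y)) p *
       'D_(delta_mx 0 l) (frame_coord d w k) p).
Proof.
move=> ad oD sf Pp.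
have dp : (cfwd d @` cdom d) p by case: Pp => x [dx _] <-; exists x.
rewrite (lder_chart _ ad oD (lder_smooth w oD sf))//.
apply: eq_bigr => l _; rewrite -mulr_sumr; congr (_ * _).
pose h (k : 'I_n) q := frame_coord d w k q *
    'D_(delta_mx 0 k) (fun y => f (cbwd d y)) q.
have dB k : derivable (frame_coord d w k) p (delta_mx 0 l).
  apply: diff_derivable.
  by have [+ _] := frame_coord_smooth w k 1 ad; apply.
have dF (k : 'I_n) : derivable (fun q => 'D_(delta_mx 0 k) (fun y => f (cbwd d y)) q) p (delta_mx 0 l).
  apply: diff_derivable.
  by have [_ /(_ (delta_mx 0 k))[+ _]] := smooth_fun_diff_n 2 ad oD sf; apply.
rewrite (@near_eq_derive _ _ _ _ (\sum_(k < n) h k)).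
  rewrite derive_sum => [|k]; last exact: derivableM.
  by apply: eq_bigr => k _; rewrite deriveM.
apply: filterS (chart_img_near oD Pp) => q Pq.
by rewrite (lder_chart _ ad oD sf)// fct_sumE.
Qed.

End Frame.
End LieCalculus.

(** * Horizontal derivatives and the flow speed *)

Section Horizontal.
Context {R : realType} {n m1 : nat} {G : carnotGroup R n m1}.
Implicit Types (D : set G) (f : G -> R).

Lemma hder_local D f g (i : 'I_m1) x : open D -> (forall y, D y -> f y = g y) ->
  D x -> hder i f x = hder i g x.
Proof. exact: lder_local (chart1_dom G) _ _ _ _ _. Qed.

Lemma hder_smooth D f (i : 'I_m1) : open D -> smooth_fun D f ->
  smooth_fun D (hder i f).
Proof. exact: lder_smooth (chart1_atlas G) (chart1_dom G) _ _ _. Qed.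

Lemma hderB D f g (i : 'I_m1) x : open D -> smooth_fun D f -> smooth_fun D g ->
  D x -> hder i (fun x => f x - g x) x = hder i f x - hder i g x.
Proof.
by move=> oD sf sg Dx; exact: (lderB (chart1_atlas G) (chart1_dom G) _ oD sf sg Dx).
Qed.

Lemma hgrad_local D f g x : open D -> (forall y, D y -> f y = g y) ->
  D x -> hgrad f x = hgrad g x.
Proof.
by move=> oD fg Dx; apply/rowP => i; rewrite !mxE; exact: hder_local fg Dx.
Qed.

Lemma sym_hhess_local D f g x : open D -> (forall y, D y -> f y = g y) ->
  D x -> sym_hhess f x = sym_hhess g x.
Proof.
move=> oD fg Dx; rewrite /sym_hhess.
suff -> : hhess f x = hhess g x by [].
apply/matrixP => i j; rewrite [LHS]mxE [RHS]mxE.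
by apply: (hder_local i oD _ Dx) => y Dy; exact: (hder_local j oD fg Dy).
Qed.

Lemma hgradB D f g x : open D -> smooth_fun D f -> smooth_fun D g -> D x ->
  hgrad (fun x => f x - g x) x = hgrad f x - hgrad g x.
Proof.
by move=> oD sf sg Dx; apply/rowP => i; rewrite !mxE (hderB i oD sf sg).
Qed.

Lemma sym_hhessB D f g x : open D -> smooth_fun D f -> smooth_fun D g -> D x ->
  sym_hhess (fun x => f x - g x) x = sym_hhess f x - sym_hhess g x.
Proof.
move=> oD sf sg Dx; rewrite /sym_hhess.
suff -> : hhess (fun x => f x - g x) x = hhess f x - hhess g x.
  by rewrite linearB/= -scalerBr addrACA opprD.
apply/matrixP => i j; rewrite !mxE.
rewrite (hder_local (g := fun y => hder j f y - hder j g y) i oD _ Dx).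
  exact: hderB oD (hder_smooth j oD sf) (hder_smooth j oD sg) Dx.
by move=> y Dy; rewrite (hderB j oD sf sg).
Qed.

Lemma sym_hhess_tr f x : (sym_hhess f x)^T = sym_hhess f x.
Proof. by rewrite /sym_hhess linearZ/= linearD/= trmxK addrC. Qed.

Lemma quad_form_sym_hhess f x (v : 'rV[R]_m1) :
  (v *m sym_hhess f x *m v^T) 0 0 = \sum_i \sum_j v 0 i * (v 0 j * hhess f x i j).
Proof.
rewrite /sym_hhess -scalemxAr -scalemxAl mulmxDr mulmxDl 2!mxE quad_form_tr.
have -> (a : R) : 2^-1 * (a + a) = a by field.
by rewrite quad_formE.
Qed.

(** In a chart the full gradient vanishes at the minimum, not only the horizontal one. This removes
    the first-order terms of the iterated fields, and the Hessian form in v becomes the ordinary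
    second derivative in the constant direction b, the value at p of the combination of the frame
    fields with coefficients v. *)
Lemma interior_min D f x : open D -> smooth_fun D f -> D x ->
  (\forall y \near x, f x <= f y) ->
  hgrad f x = 0 /\ forall v : 'rV[R]_m1, 0 <= (v *m sym_hhess f x *m v^T) 0 0.
Proof.
move=> oD sf Dx minf; have [d ad dx] := atlas_cover x.
pose p := cfwd d x; pose F y := f (cbwd d y).
pose P := cfwd d @` (cdom d `&` D).
have oP : open P by exact: chart_img_open.
have Pp : P p by exists x.
have bp : cbwd d p = x by exact: cfwdK.
have dF : diff_n 2 P F by exact: smooth_fun_diff_n.
have minF : \forall q \near p, F p <= F q.
  rewrite /F bp; have dp : (cfwd d @` cdom d) p by exists x.
  have := cbwd_cvg dp; rewrite bp => cb; exact: (cb [set y | f x <= f y] minf).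
have crit v : 'D_v F p = 0 by have [] := derive_at_min v oP Pp dF minF.
split.
  apply/rowP => i; rewrite !mxE /hder -bp.
  rewrite (lder_chart (chart1_atlas G) (chart1_dom G) _ ad oD sf)//.
  by rewrite big1// => k _; rewrite crit mulr0.
move=> v; rewrite quad_form_sym_hhess.
pose B (i : 'I_m1) k := frame_coord (chart1 G) d (tnth (frame G) i) k p.
pose b : 'rV[R]_n := \row_k \sum_i v 0 i * B i k.
suff -> : \sum_i \sum_j v 0 i * (v 0 j * hhess f x i j) =
    'D_b (fun q => 'D_b F q) p.
  by have [] := derive_at_min b oP Pp dF minF.
rewrite (derive2_sum_coord _ _ oP Pp dF).
pose S (l k : 'I_n) : R := 'D_(delta_mx 0 l) (fun q => 'D_(delta_mx 0 k) F q) p.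
transitivity (\sum_i \sum_j \sum_l \sum_k
    v 0 i * B i l * (v 0 j * B j k) * S l k).
  apply: eq_bigr => i _; apply: eq_bigr => j _; rewrite mxE /hder -{1}bp.
  rewrite (lder2_chart (chart1_atlas G) (chart1_dom G) _ _ ad oD sf)//.
  rewrite !mulr_sumr; apply: eq_bigr => l _; rewrite !mulr_sumr.
  apply: eq_bigr => k _; rewrite -/F crit mul0r addr0 -/(S l k) -!/(B _ _).
  by ring.
transitivity (\sum_l \sum_k \sum_i \sum_j
    v 0 i * B i l * (v 0 j * B j k) * S l k).
  under eq_bigr do rewrite exchange_big/=.
  rewrite exchange_big/=; apply: eq_bigr => l _.
  under eq_bigr do rewrite exchange_big/=.
  by rewrite exchange_big.
apply: eq_bigr => l _; apply: eq_bigr => k _; rewrite !mxE -/(S l k).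
rewrite mulrA big_distrlr/= mulr_suml; apply: eq_bigr => i _.
by rewrite mulr_suml.
Qed.

Lemma hgrad_continuous D f (i : 'I_m1) x : open D -> smooth_fun D f -> D x ->
  {for x, continuous (fun y => hgrad f y 0 i)}.
Proof.
move=> oD sf Dx.
have -> : (fun y => hgrad f y 0 i) = hder i f by apply/funext => y; rewrite mxE.
exact: smooth_fun_continuous oD (hder_smooth i oD sf) Dx.
Qed.

Lemma sym_hhess_continuous D f (i j : 'I_m1) x : open D -> smooth_fun D f ->
  D x -> {for x, continuous (fun y => sym_hhess f y i j)}.
Proof.
move=> oD sf Dx.
have cH k l : {for x, continuous (hder k (hder l f))}.
  exact: smooth_fun_continuous oD (hder_smooth k oD (hder_smooth l oD sf)) Dx.
have -> : (fun y => sym_hhess f y i j) =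
    (fun y => 2^-1 * (hder i (hder j f) y + hder j (hder i f) y)).
  by apply/funext => y; rewrite !mxE.
by apply: cvgM; [exact: cvg_cst|apply: cvgD; exact: cH].
Qed.

Definition flow_speed f x : R :=
  det_plus (sym_hhess f x) / Num.sqrt (1 + sqr_norm (hgrad f x)) ^+ m1.+1.

Lemma flow_speed_denom_gt0 f x :
  0 < Num.sqrt (1 + sqr_norm (hgrad f x)) ^+ m1.+1.
Proof.
rewrite exprn_gt0// sqrtr_gt0 ltr_wpDr//.
by apply: sumr_ge0 => i _; exact: sqr_ge0.
Qed.

(** The entries of the symmetrized Hessian are continuous, so the numerator stays above a positive
    constant near x, while the gradient in the denominator stays bounded. *)
Lemma flow_speed_lower_bound D f x : open D -> smooth_fun D f -> D x ->
  pos_def (sym_hhess f x) ->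
  exists2 c : R, 0 < c & \forall y \near x, c <= flow_speed f y.
Proof.
move=> oD sf Dx pH.
have [e e0 [c c0 cP]] := pos_def_stable (sym_hhess_tr f x) pH.
have nH : \forall y \near x, forall ij : 'I_m1 * 'I_m1,
    `|sym_hhess f y ij.1 ij.2 - sym_hhess f x ij.1 ij.2| <= e.
  apply: filter_forall => -[i j] /=.
  exact: (continuous_near_le (@sym_hhess_continuous D f i j x oD sf Dx) e0).
have cN : (fun y => sqr_norm (hgrad f y)) @ x --> sqr_norm (hgrad f x).
  have cg := fun i => @hgrad_continuous D f i x oD sf Dx.
  apply: (@cvg_sum_ord _ _ _ _ _ (fun i y => hgrad f y 0 i ^+ 2)
    (fun i => hgrad f x 0 i ^+ 2)) => i.
  exact: (cvgM (cg i) (cg i)).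
pose K := sqr_norm (hgrad f x) + 1.
have nK : \forall y \near x, sqr_norm (hgrad f y) <= K.
  by apply: (cvgr_le _ cN); rewrite ltrDl.
have K0 : 0 < K by rewrite ltr_wpDl// sumr_ge0// => i _; exact: sqr_ge0.
have S0 : 0 < Num.sqrt (1 + K) ^+ m1.+1 by rewrite exprn_gt0// sqrtr_gt0 addr_gt0.
exists (c / Num.sqrt (1 + K) ^+ m1.+1); first by rewrite divr_gt0.
apply: filterS2 nH nK => y nH nK.
apply: ler_pM; [exact: ltW|by rewrite invr_ge0 ltW| |].
  by apply: cP; [exact: sym_hhess_tr|move=> i j; exact: (nH (i, j))].
rewrite lef_pV2 ?posrE ?flow_speed_denom_gt0//.
by rewrite lerXn2r ?nnegrE ?sqrtr_ge0// ler_wsqrtr// lerD2l.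
Qed.

Lemma flow_speed_gt0 f x : 0 < flow_speed f x -> pos_def (sym_hhess f x).
Proof.
rewrite pmulr_lgt0 ?invr_gt0 ?flow_speed_denom_gt0//.
exact: det_plus_gt0_pos_def (sym_hhess_tr f x).
Qed.

Lemma flow_speed_le_at_min D f g x : open D -> smooth_fun D f ->
  smooth_fun D g -> D x -> (\forall y \near x, f x - g x <= f y - g y) ->
  flow_speed g x <= flow_speed f x.
Proof.
move=> oD sf sg Dx minfg.
have [hg hh] := interior_min oD (smooth_funB oD sf sg) Dx minfg.
move: hg; rewrite (hgradB oD sf sg Dx) => /eqP; rewrite subr_eq0 => /eqP hg.
rewrite /flow_speed hg; apply: ler_wpM2r.
  by rewrite invr_ge0; exact: ltW (flow_speed_denom_gt0 g x).
apply: det_plus_le; [exact: sym_hhess_tr|exact: sym_hhess_tr|move=> v].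
have := hh v; rewrite (sym_hhessB oD sf sg Dx).
by rewrite quad_formB subr_ge0.
Qed.

Lemma flow_speed_local D f g x : open D -> (forall y, D y -> f y = g y) ->
  D x -> flow_speed f x = flow_speed g x.
Proof.
move=> oD fg Dx.
by rewrite /flow_speed (sym_hhess_local oD fg Dx) (hgrad_local oD fg Dx).
Qed.

End Horizontal.

(** * Curves in a Lie group *)

Section RealInduction.
Context {R : realType}.

(** Continuity method, for estimates that are available only infinitesimally: following a curve
    inside a chart, and increments from one-sided derivatives. The supremum m of the good initial
    segments satisfies P by [lim], and [step] would push it further if m < b. *)
Lemma real_induction (P : R -> Prop) (a b : R) : P a ->
  (forall t, a <= t < b -> (forall s, a <= s <= t -> P s) ->
     exists2 e, 0 < e & forall s, t < s < t + e -> s <= b -> P s) ->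
  (forall t, a < t <= b -> (forall s, a <= s < t -> P s) -> P t) ->
  forall t, a <= t <= b -> P t.
Proof.
move=> Pa step lim t /andP[at_ tb].
pose E := [set r : R | a <= r <= b /\ forall s, a <= s <= r -> P s].
have Ea : E a.
  split; first by rewrite lexx (le_trans at_).
  by move=> s /andP[as_ sa]; have -> : s = a by apply/eqP; rewrite eq_le as_ sa.
have ubE : ubound E b by move=> r [/andP[]].
have supE : has_sup E by split; [exists a|exists b].
set m := sup E.
have am : a <= m by exact: (sup_upper_bound supE).
have mb : m <= b by apply: ge_sup => //; exists a.
have Plt s : a <= s < m -> P s.
  move=> /andP[as_ sm]; rewrite -subr_gt0 in sm.
  have [r [rb Pr]] := sup_adherent sm supE; rewrite -/m subKr => sr.
  by apply: Pr; rewrite as_ ltW.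
have Pm : P m.
  have [<-//|am'] := eqVneq a m; apply: lim => //.
  by rewrite mb lt_neqAle am' am.
have Ple s : a <= s <= m -> P s.
  move=> /andP[as_]; rewrite le_eqVlt => /predU1P[->//|sm].
  by apply: Plt; rewrite as_.
have [mb'|bm] := ltP m b; last by apply: Ple; rewrite at_ (le_trans tb).
have [e e0 Pe] := step m (introT andP (conj am mb')) Ple.
exfalso; pose r := Num.min (m + e / 2) b.
have mr : m < r by rewrite lt_min mb' andbT ltrDl divr_gt0.
have re : r < m + e.
  by rewrite (@le_lt_trans _ _ (m + e / 2)) ?ge_min ?lexx// ltrD2l ltr_pdivrMr// ltr_pMr// ltr1n.
have rb : r <= b by rewrite ge_min lexx orbT.
suff : r <= m by rewrite leNgt mr.
apply: (sup_upper_bound supE); split; first by rewrite rb (le_trans am (ltW mr)).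
move=> s /andP[as_ sr]; have [sm|ms] := leP s m; first by apply: Ple; rewrite as_.
by apply: Pe; [rewrite ms (le_lt_trans sr)|exact: le_trans rb].
Qed.

Lemma le_add_dist (x y e : R) : `|x - y| <= e -> y <= x + e.
Proof. by rewrite ler_norml => /andP[+ _]; lra. Qed.

Lemma nondecreasing_of_deriv (L l : R -> R) (s t : R) : s <= t ->
  (forall x : R, s <= x <= t -> is_derive x 1 L (l x)) ->
  (forall x, s <= x <= t -> 0 <= l x) -> L s <= L t.
Proof.
move=> st dL l0.
have [x xst||x xst] := @MVT_segment _ L l s t st.
- by apply: dL; rewrite !(itvP xst).
- apply: derivable_within_continuous => y yst.
  by have [] := dL y _; rewrite ?(itvP yst).
rewrite -subr_ge0 => ->; apply: mulr_ge0; last by rewrite subr_ge0.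
by apply: l0; rewrite !(itvP xst).
Qed.

End RealInduction.

(** * Lipschitz estimate for the multiplication near the unit *)

Section ChartLipschitz.
Context {R : realType} {n : nat} {G : lieGroup R n}.
Variables (c : chart R n G) (ac : atlas c) (c1 : cdom c 1%g).
Let o := cfwd c 1%g.

Lemma row_normr_le (w : 'rV[R]_n) k : `|w 0 k| <= `|w|.
Proof.
by rewrite [leRHS]/Num.Def.normr/= mx_normrE (le_trans _ (le_bigmax _ _ (0, k))).
Qed.

Lemma row_normr_lub (w : 'rV[R]_n) (e : R) : 0 <= e ->
  (forall k, `|w 0 k| <= e) -> `|w| <= e.
Proof.
move=> e0 we; rewrite [leLHS]/Num.Def.normr/= mx_normrE bigmax_le// => -[i k] _.
by rewrite /= ord1.
Qed.

(** Since [chart_mul c c (p, o)] is p, the difference is an increment in the second factor alone;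
    the mean value theorem along the segment from o to z bounds it by the partial derivatives near
    (o, o). *)
Lemma chart_mul_lipschitz : exists2 r : R, 0 < r & exists2 M : R, 0 < M &
  forall p z : 'rV[R]_n, `|p - o| < r -> `|z - o| < r ->
    chart_mul_dom c c (p, z) /\
    `|chart_mul c c (p, z) - p| <= M * `|z - o|.
Proof.
have oo : chart_mul_dom c c (o, o) by apply: chart_mul_dom_unit => //; exists 1%g.
pose DM (k j : 'I_n) q := 'D_(0, delta_mx 0 j) (fun q => chart_mul c c q 0 k) q.
(* Each + 1 allows a partial derivative to vary on the ball of radius r; the further + 1 in the
   witness keeps the Lipschitz constant positive when n = 0. *)
pose M0 : R := \sum_k \sum_j (`|DM k j (o, o)| + 1).
have [r r0 rP] : exists2 r : R, 0 < r & forall q : 'rV[R]_n * 'rV[R]_n, `|q - (o, o)| < r ->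
    chart_mul_dom c c q /\ forall kj : 'I_n * 'I_n, `|DM kj.1 kj.2 q| <= `|DM kj.1 kj.2 (o, o)| + 1.
  have n1 : nbhs (o, o) (chart_mul_dom c c).
    by apply: open_nbhs_nbhs; split => //; exact: chart_mul_dom_open.
  have n2 (kj : 'I_n * 'I_n) : \forall q \near (o, o),
      `|DM kj.1 kj.2 q| <= `|DM kj.1 kj.2 (o, o)| + 1.
    have [_ /(_ (0, delta_mx 0 kj.2))[dD _]] := chart_mul_smooth ac kj.1 2 ac.
    have cD : {for (o, o), continuous (DM kj.1 kj.2)}.
      exact: differentiable_continuous (dD _ oo).
    apply: filterS (continuous_near_le cD ltr01) => q qo.
    by rewrite -lerBlDl (le_trans _ qo)// lerB_dist.
  have [r r0 rP] := near_pos_ball (filterI n1 (filter_forall _ n2)).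
  by exists r => // q /rP[].
exists r => //; exists (M0 + 1).
  by rewrite ltr_wpDl// sumr_ge0// => k _; rewrite sumr_ge0// => j _; rewrite addr_ge0.
move=> p z po zo.
have seg t : 0 <= t <= 1 -> `|(p, t *: (z - o) + o) - (o, o)| < r.
  move=> /andP[t0 t1]; rewrite prod_normE/= gt_max po/= addrK normrZ ger0_norm//.
  by rewrite (le_lt_trans _ zo)// ler_piMl.
split.
  have s1 := seg 1; rewrite scale1r subrK lexx ler01 in s1.
  by have [] := rP _ (s1 isT).
apply: row_normr_lub.
  by rewrite mulr_ge0// addr_ge0// sumr_ge0// => k _; rewrite sumr_ge0// => j _; rewrite addr_ge0.
move=> k; rewrite !mxE.
pose phi t := chart_mul c c (p, t *: (z - o) + o) 0 k.
pose psi t := 'D_(z - o) (fun w => chart_mul c c (p, w) 0 k) (t *: (z - o) + o).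
have dmul t : 0 <= t <= 1 ->
    differentiable (fun w => chart_mul c c (p, w) 0 k) (t *: (z - o) + o).
  move=> t01; apply: (@differentiable_slicer _ _ _ (fun q => chart_mul c c q 0 k)).
  have [+ _] := chart_mul_smooth ac k 1 ac; apply.
  by have [] := rP _ (seg t t01).
have dphi (t : R) : 0 <= t <= 1 -> is_derive t 1 phi (psi t).
  move=> t01; apply: (@is_derive_line _ _ (fun w => chart_mul c c (p, w) 0 k)).
  exact/diff_derivable/dmul.
have [||t t01] := @MVT _ phi psi 0 1 ltr01.
- by move=> t t01; apply: dphi; rewrite ?(itvP t01).
- apply: derivable_within_continuous => t t01.
  by have [] := dphi t _; rewrite ?(itvP t01).
rewrite {1}/phi {1}/phi scale1r scale0r add0r subrK subr0 mulr1.
have -> : chart_mul c c (p, o) = p.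
  rewrite /chart_mul/= cbwd_unit_coord// mulg1.
  have s0 := seg 0; rewrite scale0r add0r lexx ler01 in s0.
  have [[cp _ _] _] := rP _ (s0 isT).
  by have [] := cbwd_img cp.
have t01' : 0 <= t <= 1 by rewrite !(itvP t01).
move=> ->; rewrite /psi derive_sum_coord; last exact: dmul.
apply: le_trans (ler_norm_sum _ _ _) _.
apply: (@le_trans _ _ (\sum_j (`|DM k j (o, o)| + 1) * `|z - o|)).
  apply: ler_sum => j _; rewrite normrM mulrC ler_pM//.
    rewrite (@derive_slicer _ _ _ (fun q => chart_mul c c q 0 k)).
    exact: ((rP _ (seg t t01')).2 (k, j)).
  exact: row_normr_le.
rewrite -mulr_suml ler_wpM2r//.
rewrite /M0 [X in _ <= X + 1](bigD1 k)//= -addrA lerDl addr_ge0// sumr_ge0// => i _.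
by rewrite sumr_ge0// => j _; rewrite addr_ge0.
Qed.

End ChartLipschitz.

Section HasDeriv.
Context {R : realType} {V : normedModType R}.

Lemma has_deriv_inP (I : set R) (f : R -> V) (t : R) (l : V) (e : R) :
  has_deriv_in I f t l -> 0 < e ->
  exists2 d : R, 0 < d & forall h : R, `|h| < d -> I (t + h) -> h != 0 ->
    `|f (t + h) - f t - h *: l| <= e * `|h|.
Proof.
move=> /cvgrPdist_le fl e0.
have : \forall h \near 0^', I (t + h) ->
    `|l - h^-1 *: (f (t + h) - f t)| <= e by exact: fl e e0.
move=> /nbhs_norm0P[d /= d0 dP]; exists d => // h hd It h0.
have := dP h hd h0 It.
rewrite distrC => le; have -> : f (t + h) - f t - h *: l =
    h *: (h^-1 *: (f (t + h) - f t) - l).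
  by rewrite scalerBr scalerA divff// scale1r.
by rewrite normrZ mulrC; apply: ler_wpM2r.
Qed.

Lemma is_derive_has_deriv_in (I : set R) (f : R -> V) (t : R) (l : V) :
  is_derive t 1 f l -> has_deriv_in I f t l.
Proof.
move=> [dex <-]; apply: cvg_within_filter.
have -> : (fun h => h^-1 *: (f (t + h) - f t)) =
    (fun h => h^-1 *: ((f \o shift t) (h *: 1) - f t)).
  by apply/funext => h /=; rewrite [h *: 1]mulr1 [t + h]addrC.
exact: dex.
Qed.

End HasDeriv.

(** * Displacement along a curve controlled by its length *)

Section Growth.
Context {R : realType} {n : nat} {G : lieGroup R n}.
Variables (c : chart R n G) (ac : atlas c) (c1 : cdom c 1%g).
Let o := cfwd c 1%g.
Variables (r M : R).
Hypothesis M_gt0 : 0 < M.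
Hypothesis lip : forall p z : 'rV[R]_n, `|p - o| < r -> `|z - o| < r ->
  chart_mul_dom c c (p, z) /\ `|chart_mul c c (p, z) - p| <= M * `|z - o|.

Definition chart_ball (k : R) : set G := cbwd c @` [set p | `|p - o| <= k].

Lemma chart_ball_img k p : k < r -> `|p - o| <= k -> (cfwd c @` cdom c) p.
Proof.
move=> kr pk; have pr : `|p - o| < r by exact: le_lt_trans kr.
by have [[]] := lip pr pr.
Qed.

Lemma chart_ball_compact k : k < r -> compact (chart_ball k).
Proof.
move=> kr; apply: continuous_compact.
  apply: continuous_subspaceW (@cbwd_continuous _ _ _ c) => p.
  exact: chart_ball_img.
apply: bounded_closed_compact.
  exists (k + `|o|); split; first exact: num_real.
  move=> x kx p /= pk; apply: le_trans (ltW kx).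
  by rewrite -(subrK o p) (le_trans (ler_normD _ _))// lerD2r.
have -> : [set p | `|p - o| <= k] = closed_ball_ Num.norm o k.
  by apply/funext => p; rewrite /closed_ball_/= distrC.
exact: closed_closed_ball_.
Qed.

Lemma chart_ball_unit k : 0 <= k -> chart_ball k 1%g.
Proof.
by move=> k0; exists o; [rewrite /= subrr normr0|exact: cfwdK].
Qed.

Lemma chart_ballP k x : k < r -> chart_ball k x ->
  cdom c x /\ `|cfwd c x - o| <= k.
Proof.
move=> kr [p pk <-]; have [dp fp] := cbwd_img (chart_ball_img kr pk).
by rewrite fp.
Qed.

(** In the application L is the arc length of gam, l its speed for the inner product, and C compares
    the coordinate norm on the first layer with the inner-product norm. *)
Variables (gam : R -> G) (a : R -> 'rV[R]_n) (L l : R -> R) (C : R).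
Hypothesis C_gt0 : 0 < C.
Hypothesis gam_cont : {within `[0, 1], continuous gam}.
Hypothesis gam_deriv : forall t, 0 <= t <= 1 ->
  has_deriv_in `[0, 1] (fun s => cfwd c ((gam t)^-1 * gam s)%g) t (a t).
Hypothesis a_le : forall t, 0 <= t <= 1 -> `|a t| <= C * l t.
Hypothesis L_deriv : forall t : R, 0 <= t <= 1 -> is_derive t 1 L (l t).

Lemma speed_ge0 t : 0 <= t <= 1 -> 0 <= l t.
Proof. by move=> /a_le /(le_trans (normr_ge0 _)); rewrite pmulr_rge0. Qed.

Lemma L_nondecreasing s t : 0 <= s -> s <= t -> t <= 1 -> L s <= L t.
Proof.
move=> s0 st t1.
apply: nondecreasing_of_deriv st _ _ => x /andP[sx xt].
  by apply: L_deriv; rewrite (le_trans s0 sx) (le_trans xt t1).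
by apply: speed_ge0; rewrite (le_trans s0 sx) (le_trans xt t1).
Qed.

Lemma gam_near (x : G) t D : 0 <= t <= 1 -> open D -> D (x * gam t)%g ->
  exists2 e : R, 0 < e & forall s, 0 <= s <= 1 -> `|s - t| < e ->
    D (x * gam s)%g.
Proof.
move=> t01 oD Dt.
have /subspace_continuousP/(_ t t01) gt := gam_cont.
have : \forall s \near within `[0, 1] (nbhs t), D (x * gam s)%g.
  have := cvg_comp _ _ gt (@mulg_continuousr _ _ _ x (gam t)); apply.
  exact: open_nbhs_nbhs.
by move=> /near_pos_ball[e e0 eP]; exists e => // s s01 st; apply: eP.
Qed.

(** The new displacement is the old one times [(gam t)^-1 * gam (t + h)], whose coordinates differ
    from o by [h *: a t] up to a small error; the Lipschitz estimate for right factors near the unit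
    applies. *)
Lemma curve_growth_step (t0 t : R) (eta : R) : 0 < eta ->
  0 <= t0 <= 1 -> 0 <= t <= 1 ->
  cdom c ((gam t0)^-1 * gam t)%g ->
  `|cfwd c ((gam t0)^-1 * gam t)%g - o| < r ->
  0 < r ->
  exists2 e : R, 0 < e & forall h : R, 0 < h < e -> 0 <= t + h <= 1 ->
    cdom c ((gam t0)^-1 * gam (t + h))%g /\
    `|cfwd c ((gam t0)^-1 * gam (t + h))%g - o| <=
    `|cfwd c ((gam t0)^-1 * gam t)%g - o| + M * C * (L (t + h) - L t) + eta * h.
Proof.
move=> eta0 t001 t01 dw yr r0.
(* Differentiating the curve costs eps h and differentiating L costs C eps h; after the factor M the
   total is exactly eta h. *)
pose eps := eta / (M * (C + 1)).
have C1 : 0 < C + 1 by rewrite addr_gt0.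
have eps0 : 0 < eps by rewrite divr_gt0// mulr_gt0.
have [e1 e10 zP] := has_deriv_inP (gam_deriv t01) eps0.
have [e2 e20 LP] := has_deriv_inP
  (@is_derive_has_deriv_in _ _ setT _ _ _ (L_deriv t01)) eps0.
have tt : ((gam t)^-1 * gam t)%g = 1%g by rewrite mulVg.
have [e3 e30 dP] : exists2 e : R, 0 < e & forall s, 0 <= s <= 1 ->
    `|s - t| < e -> cdom c ((gam t)^-1 * gam s)%g.
  by apply: gam_near => //; [exact: cdom_open|rewrite tt].
pose e4 := r / (C * l t + eps + 1).
have den : 0 < C * l t + eps + 1.
  by rewrite addr_gt0// ltr_wpDl// mulr_ge0 ?speed_ge0// ltW.
have e40 : 0 < e4 by rewrite divr_gt0.
exists (Num.min (Num.min e1 e2) (Num.min e3 e4)); first by rewrite !lt_min e10 e20 e30.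
move=> h /andP[h0]; rewrite !lt_min => /andP[/andP[h1 h2] /andP[h3 h4]] th01.
have hn : `|h| = h by rewrite gtr0_norm.
have hneq : h != 0 by rewrite gt_eqF.
pose z := cfwd c ((gam t)^-1 * gam (t + h))%g.
have dz : cdom c ((gam t)^-1 * gam (t + h))%g.
  by apply: dP => //; rewrite addrAC subrr add0r hn.
have zo : `|z - o| <= h * (C * l t + eps).
  have := zP h; rewrite hn tt -/o -/z => /(_ h1 th01 hneq) zh.
  have -> : z - o = (z - o - h *: a t) + h *: a t by rewrite subrK.
  apply: le_trans (ler_normD _ _) _.
  rewrite normrZ hn mulrDr addrC lerD//; last by rewrite mulrC.
  by rewrite ler_pM2l// a_le.
have zr : `|z - o| < r.
  apply: (le_lt_trans zo).
  apply: (@le_lt_trans _ _ (h * (C * l t + eps + 1))).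
    by rewrite ler_pM2l// lerDl.
  by rewrite -ltr_pdivlMr.
have [[_ _ dprod] mulP] := lip yr zr.
have wE : (cbwd c (cfwd c ((gam t0)^-1 * gam t)) * cbwd c z)%g =
    ((gam t0)^-1 * gam (t + h))%g.
  by rewrite /z !cfwdK// -mulgA mulVKg.
rewrite /= wE in dprod; split => //.
rewrite /chart_mul/= wE in mulP.
have Lh : h * l t <= L (t + h) - L t + eps * h.
  have := LP h; rewrite hn => /(_ h2 I hneq).
  exact: le_add_dist.
set y1 := cfwd c (_ * gam (t + h))%g in mulP *.
set y0 := cfwd c (_ * gam t)%g in mulP *.
have -> : y1 - o = (y0 - o) + (y1 - y0) by rewrite [RHS]addrC addrA subrK.
apply: le_trans (ler_normD _ _) _; rewrite -addrA lerD2l.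
apply: (le_trans mulP).
apply: (@le_trans _ _ (M * (C * (L (t + h) - L t + eps * h) + eps * h))).
  rewrite ler_pM2l//; apply: (le_trans zo).
  by rewrite mulrDr [h * eps]mulrC lerD2r mulrCA ler_pM2l.
have -> : eta = eps * (M * (C + 1)) by rewrite divfK// gt_eqF// mulr_gt0.
by rewrite le_eqVlt; apply/orP; left; apply/eqP; ring.
Qed.

(** The estimate for small steps is valid only while the displacement remains within r in the chart,
    hence real induction, with a slack eta (s - t0) that absorbs the error of each step and is
    finally sent to 0. *)
Lemma curve_growth (t0 t1 : R) : 0 <= t0 -> t0 <= t1 -> t1 <= 1 ->
  M * C * (L t1 - L t0) < r ->
  chart_ball (M * C * (L t1 - L t0)) ((gam t0)^-1 * gam t1)%g.
Proof.
move=> t00 t01 t11 small.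
have r0 : 0 < r.
  apply: le_lt_trans small; rewrite mulr_ge0 ?subr_ge0 ?L_nondecreasing//.
  by rewrite mulr_ge0// ltW.
have t0I : 0 <= t0 <= 1 by rewrite t00 (le_trans t01).
have sI s : t0 <= s <= t1 -> 0 <= s <= 1.
  by move=> /andP[t0s st1]; rewrite (le_trans t00 t0s) (le_trans st1).
have MC0 : 0 < M * C by rewrite mulr_gt0.
pose bound eta s := M * C * (L s - L t0) + eta * (s - t0).
have bound_le eta s s' : 0 < eta -> t0 <= s -> s <= s' -> s' <= t1 ->
    bound eta s <= bound eta s'.
  move=> eta0 t0s ss' s't; rewrite lerD//.
    rewrite ler_pM2l// lerD2r L_nondecreasing//; first exact: le_trans t0s.
    exact: le_trans t11.
  by rewrite ler_pM2l// lerD2r.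
have key eta : 0 < eta -> bound eta t1 < r ->
    chart_ball (bound eta t1) ((gam t0)^-1 * gam t1)%g.
  move=> eta0 br.
  have br' s : t0 <= s <= t1 -> bound eta s < r.
    by move=> /andP[t0s st1]; apply: le_lt_trans br; exact: bound_le.
  pose P s := chart_ball (bound eta s) ((gam t0)^-1 * gam s)%g.
  apply: (@real_induction _ P t0 t1); last by rewrite t01 lexx.
  - rewrite /P mulVg /bound !subrr !mulr0 addr0; exact: chart_ball_unit.
  - move=> t /andP[t0t tt1] Pt.
    have tI : t0 <= t <= t1 by rewrite t0t ltW.
    have {}Pt : P t by apply: Pt; rewrite t0t lexx.
    have [dw yb] := chart_ballP (br' t tI) Pt.
    have [e e0 eP] := curve_growth_step eta0 t0I (sI _ tI) dw
      (le_lt_trans yb (br' t tI)) r0.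
    exists e => // s /andP[ts se] st1.
    have sE : s = t + (s - t) by rewrite addrC subrK.
    have sI' : t0 <= s <= t1 by rewrite st1 (le_trans t0t (ltW ts)).
    have [||dws yws] := eP (s - t).
    - by rewrite subr_gt0 ts ltrBlDl.
    - by rewrite -sE sI.
    rewrite -sE in dws yws.
    exists (cfwd c ((gam t0)^-1 * gam s)%g); last by rewrite cfwdK.
    rewrite /=; apply: (le_trans yws).
    apply: (@le_trans _ _ (bound eta t + M * C * (L s - L t) + eta * (s - t))).
      by rewrite !lerD2r.
    by rewrite le_eqVlt; apply/orP; left; apply/eqP; rewrite /bound; ring.
  - move=> t /andP[t0t tt1] Pt.
    have tI : t0 <= t <= t1 by rewrite tt1 ltW.
    (* Passage to the limit: the ball is compact, hence closed in the Hausdorff group, so a point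
       outside it would force earlier points of the curve outside the same ball. The bound is
       nondecreasing in s, so they lie inside. *)
    apply: contrapT => nPt.
    have oB : open (~` chart_ball (bound eta t)).
      apply: closed_openC; apply: compact_closed; first exact: lie_hausdorff.
      exact/chart_ball_compact/br'.
    have [e e0 eP] := gam_near (sI _ tI) oB nPt.
    pose s := Num.max t0 (t - e / 2).
    have st : s < t by rewrite gt_max t0t ltrBlDr ltrDl divr_gt0.
    have t0s : t0 <= s by rewrite le_max lexx.
    have se : `|s - t| < e.
      rewrite ltr0_norm ?subr_lt0// opprB ltrBlDl -ltrBlDr lt_max; apply/orP; right.
      by rewrite ltrD2l ltrN2 ltr_pdivrMr// ltr_pMr// ltr1n.
    have sI' : t0 <= s <= t1 by rewrite t0s (le_trans (ltW st)).
    have := eP s (sI _ sI') se; apply.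
    have [p pb pE] := Pt s (introT andP (conj t0s st)).
    exists p => //=; apply: (le_trans pb).
    by apply: bound_le => //; exact: ltW.
have {}key eta : 0 < eta -> bound eta t1 < r ->
    cdom c ((gam t0)^-1 * gam t1)%g /\
    `|cfwd c ((gam t0)^-1 * gam t1)%g - o| <= bound eta t1.
  by move=> eta0 br; exact: chart_ballP br (key eta eta0 br).
have bE eta : 0 < eta -> bound eta t1 <= M * C * (L t1 - L t0) + eta.
  move=> eta0; rewrite lerD2l ler_piMr ?(ltW eta0)// lerBlDr.
  by rewrite (le_trans t11)// lerDl.
have gap : 0 < r - M * C * (L t1 - L t0) by rewrite subr_gt0.
have b_small eta : 0 < eta -> eta < r - M * C * (L t1 - L t0) -> bound eta t1 < r.
  by move=> eta0 eg; apply: le_lt_trans (bE eta eta0) _; rewrite addrC -ltrBrDr.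
have half : (r - M * C * (L t1 - L t0)) / 2 < r - M * C * (L t1 - L t0).
  by rewrite ltr_pdivrMr// ltr_pMr// ltr1n.
have half0 : 0 < (r - M * C * (L t1 - L t0)) / 2 by rewrite divr_gt0.
(* One admissible slack suffices to place the end point in the chart domain; the sharp norm bound
   then follows by letting the slack tend to 0. *)
have [dw _] := key _ half0 (b_small _ half0 half).
exists (cfwd c ((gam t0)^-1 * gam t1)%g); last by rewrite cfwdK.
rewrite /=; apply/ler_addgt0Pr => eta eta0.
have [s [s0 s1 s2]] := smaller_pos eta0 half0.
have [_ le] := key s s0 (b_small s s0 (lt_trans s2 half)).
apply: (le_trans le); apply: (le_trans (bE s s0)).
by rewrite lerD2l ltW.
Qed.

Definition chart_ball_pow k N : set G :=
  iter N (fun K => [set (p.1 * p.2)%g | p in K `*` chart_ball k]) [set 1%g].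

Lemma chart_ball_pow_compact k N : k < r -> compact (chart_ball_pow k N).
Proof.
move=> kr; elim: N => [|N IH]; first exact: compact_set1.
apply: continuous_compact; last exact: compact_setX IH (chart_ball_compact kr).
by apply: continuous_subspaceT; exact: lie_mul_continuous.
Qed.

(** The curve is cut into arcs whose length times M C is at most k. Each arc contributes one factor
    in the chart ball, and the displacements telescope. *)
Lemma curve_chart_ball_pow k N (t0 t1 : R) : 0 < k -> k < r ->
  0 <= t0 -> t0 <= t1 -> t1 <= 1 ->
  M * C * (L t1 - L t0) <= k * N.+1%:R ->
  chart_ball_pow k N.+1 ((gam t0)^-1 * gam t1)%g.
Proof.
move=> k0 kr t00.
have MC0 : 0 < M * C by rewrite mulr_gt0.
have onestep s t : 0 <= s -> s <= t -> t <= 1 -> M * C * (L t - L s) <= k ->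
    chart_ball k ((gam s)^-1 * gam t)%g.
  move=> s0 st t1' small.
  have [p pk pE] := curve_growth s0 st t1' (le_lt_trans small kr).
  by exists p => //=; exact: le_trans pk small.
elim: N t1 => [|N IH] t1 t01 t11 len.
  exists (1%g, ((gam t0)^-1 * gam t1)%g); last by rewrite /= mul1g.
  by split => //=; apply: onestep => //; rewrite mulr1 in len.
have [small|big] := leP (M * C * (L t1 - L t0)) (k * N.+1%:R).
  (* The curve is already short enough for one factor less; the unit pads the product. *)
  exists (((gam t0)^-1 * gam t1)%g, 1%g); last by rewrite /= mulg1.
  by split; [exact: IH|exact: chart_ball_unit (ltW k0)].
have Lmono := L_nondecreasing t00 t01 t11.
(* Arc length at which the first N + 1 factors are used up; the intermediate value theorem finds the
   time s, and the remaining arc costs at most k. *)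
pose v := L t0 + k * N.+1%:R / (M * C).
have [s /[!in_itv]/= /andP[t0s st1] sv] : exists2 s, s \in `[t0, t1]%R & L s = v.
  apply: IVT => //.
    apply: derivable_within_continuous => x xt.
    have [|//] := @L_deriv x.
    by rewrite (le_trans t00) ?(itvP xt)// (le_trans _ t11)// (itvP xt).
  rewrite min_l// max_r// /v lerDl divr_ge0 ?(mulr_ge0 (ltW k0)) ?(ltW MC0)//=.
  by rewrite -lerBrDl ler_pdivrMr// [leRHS]mulrC ltW.
have svE : M * C * (L s - L t0) = k * N.+1%:R.
  by rewrite sv /v addrC addKr mulrC divfK// gt_eqF.
exists (((gam t0)^-1 * gam s)%g, ((gam s)^-1 * gam t1)%g); last first.
  by rewrite /= -mulgA mulVKg.
split => /=.
  by apply: IH; rewrite ?svE// (le_trans st1).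
apply: onestep => //; first exact: le_trans t0s.
have E : M * C * (L t1 - L t0) = M * C * (L t1 - L s) + k * N.+1%:R.
  by rewrite -svE; ring.
have EN : k * N.+2%:R = k + k * N.+1%:R by rewrite -natr1; ring.
by move: len; rewrite E EN lerD2r.
Qed.

End Growth.

(** * Relative compactness of Carnot-Caratheodory bounded sets *)

Section CCBounded.
Context {R : realType} {n m1 : nat} {G : carnotGroup R n m1}.

Lemma inner_expand (v w : 'rV[R]_n) : inner G v w =
  \sum_i \sum_j v 0 i * w 0 j * inner G (delta_mx 0 i) (delta_mx 0 j).
Proof.
rewrite {1}[v]row_sum_delta linear_sumlz; apply: eq_bigr => i _.
rewrite {1}[w]row_sum_delta linear_sumr; apply: eq_bigr => j _.
by rewrite linearZl_LR/= linearZr_LR/= mulrA.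
Qed.

Lemma inner_continuous : continuous (fun v : 'rV[R]_n => inner G v v).
Proof.
move=> v; have -> : (fun v => inner G v v) = fun v => \sum_i \sum_j
    v 0 i * v 0 j * inner G (delta_mx 0 i) (delta_mx 0 j).
  by apply/funext => w; exact: inner_expand.
have ci k : (fun w : 'rV[R]_n => w 0 k) @ v --> v 0 k by exact: coord_continuous.
pose e i j : R := inner G (delta_mx 0 i) (delta_mx 0 j).
have cij i j : (fun w : 'rV[R]_n => w 0 i * w 0 j * e i j) @ v -->
    v 0 i * v 0 j * e i j.
  exact: (cvgM (cvgM (ci i) (ci j)) (cvg_cst _)).
exact: (cvg_sum_ord _ (fun i => cvg_sum_ord _ (cij i))).
Qed.

(** In the orthonormal frame each coordinate of v is at most its inner-product norm. The constant
    exceeds the sum of the frame norms by 1 to be positive even when m1 = 0. *)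
Lemma layer1_norm_le : exists2 C : R, 0 < C &
  forall v : 'rV[R]_n, v \in layer G 1 -> `|v| <= C * Num.sqrt (inner G v v).
Proof.
exists (\sum_(i < m1) `|tnth (frame G) i| + 1).
  by rewrite ltr_wpDl// sumr_ge0.
move=> v /(coord_basis (frame_basis G)) vE.
pose al i := coord (frame G) i v.
have {}vE : v = \sum_i al i *: tnth (frame G) i.
  by rewrite {1}vE; apply: eq_bigr => i _; rewrite (tnth_nth 0).
have nE : inner G v v = \sum_i al i ^+ 2.
  rewrite {1}vE linear_sumlz; apply: eq_bigr => i _.
  rewrite linearZl_LR/= {1}vE linear_sumr (bigD1 i)//= big1 ?addr0 => [|j ji].
    by rewrite linearZr_LR/= frame_orthonormal eqxx mulr1 expr2.
  by rewrite linearZr_LR/= frame_orthonormal eq_sym (negbTE ji) mulr0.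
have al_le i : `|al i| <= Num.sqrt (inner G v v).
  rewrite -sqrtr_sqr ler_wsqrtr// nE (bigD1 i)//= lerDl.
  by apply: sumr_ge0 => j _; exact: sqr_ge0.
rewrite {1}vE mulrDl mul1r ler_wpDr ?sqrtr_ge0//.
apply: le_trans (ler_norm_sum _ _ _) _; rewrite mulr_suml; apply: ler_sum => i _.
by rewrite normrZ mulrC ler_wpM2l.
Qed.

(** Retraction onto the unit interval. It extends the velocity continuously to the whole line, so
    that the arc length has two-sided derivatives at 0 and 1. *)
Definition clamp01 (t : R) : R := Num.max 0 (Num.min 1 t).

Lemma clamp01_itv t : clamp01 t \in `[0, 1].
Proof. by rewrite in_itv/= le_max lexx/= ge_max ler01 ge_min lexx. Qed.

Lemma clamp01_id t : 0 <= t <= 1 -> clamp01 t = t.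
Proof.
by move=> /andP[t0 t1]; rewrite /clamp01 (min_idPr t1) (max_idPr t0).
Qed.

Lemma clamp01_continuous : continuous clamp01.
Proof.
move=> t; apply: continuous_max; first exact: cvg_cst.
by apply: continuous_min; [exact: cvg_cst|exact: cvg_id].
Qed.

Lemma clamp01_comp_continuous (U : topologicalType) (f : R -> U) :
  {within `[0, 1], continuous f} -> continuous (f \o clamp01).
Proof.
move=> /subspace_continuousP cf t.
have ct := clamp01_itv t.
apply: (cvg_comp _ _ _ (cf (clamp01 t) ct)) => W Wt.
have Wt' : nbhs t [set s | clamp01 s \in `[0, 1] -> W (clamp01 s)].
  exact: (@clamp01_continuous t _ Wt).
by apply: filterS Wt' => s /= /(_ (clamp01_itv s)).
Qed.

Lemma exists_arc_length (gam : R -> G) (a : R -> 'rV[R]_n) :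
  horizontal_curve gam a ->
  exists L l : R -> R,
    [/\ forall t, 0 <= t <= 1 -> l t = Num.sqrt (inner G (a t) (a t)),
        forall t : R, 0 <= t <= 1 -> is_derive t 1 L (l t)
      & (\int[lebesgue_measure]_(t in `[0%R, 1%R])
               (Num.sqrt (inner G (a t) (a t)))%:E)%E = (L 1 - L 0)%:E].
Proof.
move=> [_ ca _].
pose l (t : R) : R := Num.sqrt (inner G (a (clamp01 t)) (a (clamp01 t))).
have cl : continuous l.
  move=> t; have c1 := @clamp01_comp_continuous _ a ca t.
  have c2 := cvg_comp _ _ c1 (@inner_continuous _).
  exact: (cvg_comp _ _ c2 (@sqrt_continuous R _)).
have il : lebesgue_measure.-integrable `[-1, 2] (EFin \o l).
  apply: continuous_compact_integrable; first exact: segment_compact.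
  exact: continuous_subspaceT.
(* Integration starts at -1 and the fundamental theorem is applied on [-1, 2], so that 0 and 1 are
   interior points. *)
pose L x := (\int[lebesgue_measure]_(t in `[-1, x]) l t)%R.
have dL (t : R) : 0 <= t <= 1 -> is_derive t 1 L (l t).
  move=> /andP[t0 t1].
  have [||||dt Lt] := @continuous_FTC1_closed R l (-1) t 2.
  - by rewrite (le_lt_trans t1)// ltr1n.
  - exact: il.
  - by rewrite (lt_le_trans _ t0)// ltrN10.
  - exact: cl.
  by split; [exact: dt|rewrite -Lt derive1E].
exists L, l; split => //.
  by move=> t t01; rewrite /l clamp01_id.
transitivity (\int[lebesgue_measure]_(t in `[0%R, 1%R]) (l t)%:E)%E.
  apply: eq_integral.
  by move=> t /[!inE]/= /[!in_itv]/= t01; rewrite /l clamp01_id.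
have cL (t : R) : 0 <= t <= 1 -> L @ t --> L t.
  by move=> /dL[dt _]; apply: differentiable_continuous; apply/derivable1_diffP.
rewrite (@continuous_FTC2 _ l L 0 1 ltr01).
- by rewrite EFinB.
- exact: continuous_subspaceT.
- split.
  + by move=> t t01; have [] := dL t _; rewrite ?(itvP t01).
  + by apply: cvg_at_right_filter; apply: cL; rewrite lexx ler01.
  + by apply: cvg_at_left_filter; apply: cL; rewrite lexx ler01.
- move=> t t01; have t01' : 0 <= t <= 1 by rewrite !(itvP t01).
  by have [_ <-] := dL t t01'; rewrite derive1E.
Qed.

Lemma cc_bounded_closure_compact (Omega : set G) :
  cc_bounded Omega -> compact (closure Omega).
Proof.
move=> [x [rho Orho]].
have [r r0 [M M0 lip]] := chart_mul_lipschitz (chart1_atlas G) (chart1_dom G).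
have [C C0 normC] := layer1_norm_le.
pose k := r / 2.
have k0 : 0 < k by rewrite divr_gt0.
have kr : k < r by rewrite ltr_pdivrMr// ltr_pMr// ltr1n.
(* Enough factors for every curve of length below rho; the absolute value is there because rho may
   be any real number. *)
pose N := Num.truncn (M * C * `|rho| / k).
have NE : M * C * `|rho| <= k * N.+1%:R.
  rewrite [leRHS]mulrC -ler_pdivrMr//; apply: ltW; exact: truncnS_gt.
pose K := [set (x * y)%g | y in chart_ball_pow (chart1 G) k N.+1].
have cK : compact K.
  apply: continuous_compact; last by apply: chart_ball_pow_compact; [exact: lip|exact: kr].
  by apply: continuous_subspaceT; exact: mulg_continuousr.
have clK : closed K by apply: compact_closed => //; exact: lie_hausdorff.
suff OK : Omega `<=` K.
  apply: (@subclosed_compact _ (closure Omega) K); [exact: closed_closure|exact: cK|].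
  by move=> y /(closure_subset OK); exact: clK.
move=> y /Orho /= /ereal_inf_lt[_ [gam [a [hc g0 g1 ->]]] len].
have [L [l [lE dL LE]]] := exists_arc_length hc.
rewrite LE lte_fin in len.
have [gc _ gd] := hc.
exists ((gam 0%R)^-1 * gam 1%R)%g; last by rewrite g0 g1 mulVKg.
have gd' (t : R) : 0 <= t <= 1 -> has_deriv_in `[0, 1]
    (fun s => cfwd (chart1 G) ((gam t)^-1 * gam s)%g) t (a t).
  move=> t01; have t01' : t \in `[0, 1] by rewrite in_itv.
  by have [_] := gd t t01'.
have al (t : R) : 0 <= t <= 1 -> `|a t| <= C * l t.
  move=> t01; have t01' : t \in `[0, 1] by rewrite in_itv.
  by rewrite lE//; apply: normC; have [+ _] := gd t t01'.
apply: (curve_chart_ball_pow (chart1_dom G) M0 lip C0 gc gd' al dL) => //.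
apply: le_trans NE; rewrite ler_pM2l ?mulr_gt0//.
by apply: (le_trans (ltW len)); exact: ler_norm.
Qed.

End CCBounded.

(** * The flow *)

Section TimeDerivative.
Context {R : realType}.

Lemma has_deriv_in_real (I : set R) (f : R -> R) (t l e : R) :
  has_deriv_in I (f : R -> R^o) t l -> 0 < e ->
  exists2 d : R, 0 < d & forall h : R, `|h| < d -> I (t + h) ->
    `|f (t + h) - f t - h * l| <= e * `|h|.
Proof.
move=> fl e0; have [d d0 dP] := has_deriv_inP fl e0.
exists d => // h hd Ih; have [->|h0] := eqVneq h 0; last exact: dP.
by rewrite addr0 subrr mul0r subr0 normr0 mulr0.
Qed.

Lemma deriv_ge_right (I : set R) (f : R -> R) (t l c e : R) :
  has_deriv_in I (f : R -> R^o) t l -> c <= l -> 0 < e ->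
  exists2 d : R, 0 < d & forall h : R, 0 <= h < d -> I (t + h) ->
    (c - e) * h <= f (t + h) - f t.
Proof.
move=> fl cl e0; have [d d0 dP] := has_deriv_in_real fl e0.
exists d => // h /andP[h0 hd] Ih.
have := dP h; rewrite ger0_norm// => /(_ hd Ih).
rewrite ler_norml => /andP[+ _]; clear - cl h0; nra.
Qed.

Lemma deriv_ge_left (I : set R) (f : R -> R) (t l c e : R) :
  has_deriv_in I (f : R -> R^o) t l -> c <= l -> 0 < e ->
  exists2 d : R, 0 < d & forall h : R, 0 <= h < d -> I (t - h) ->
    (c - e) * h <= f t - f (t - h).
Proof.
move=> fl cl e0; have [d d0 dP] := has_deriv_in_real fl e0.
exists d => // h /andP[h0 hd] Ih.
have := dP (- h); rewrite normrN ger0_norm// => /(_ hd Ih).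
rewrite ler_norml => /andP[_]; clear - cl h0; nra.
Qed.

Lemma ge_deriv_right (I : set R) (f : R -> R) (t l c d : R) :
  has_deriv_in I (f : R -> R^o) t l -> 0 < d ->
  (forall h, 0 < h < d -> I (t + h) /\ c * h <= f (t + h) - f t) -> c <= l.
Proof.
move=> fl d0 fc; apply/ler_addgt0Pr => e e0.
have [d' d'0 dP] := has_deriv_in_real fl e0.
have [h [h0 hd hd']] := smaller_pos d0 d'0.
have [|Ih ch] := fc h; first by rewrite h0.
have := dP h; rewrite gtr0_norm// => /(_ hd' Ih).
rewrite ler_norml => /andP[_]; clear - ch h0; nra.
Qed.

Lemma ge_deriv_left (I : set R) (f : R -> R) (t l c d : R) :
  has_deriv_in I (f : R -> R^o) t l -> 0 < d ->
  (forall h, 0 < h < d -> I (t - h) /\ c * h <= f t - f (t - h)) -> c <= l.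
Proof.
move=> fl d0 fc; apply/ler_addgt0Pr => e e0.
have [d' d'0 dP] := has_deriv_in_real fl e0.
have [h [h0 hd hd']] := smaller_pos d0 d'0.
have [|Ih ch] := fc h; first by rewrite h0.
have := dP (- h); rewrite normrN gtr0_norm// => /(_ hd' Ih).
rewrite ler_norml => /andP[+ _]; clear - ch h0; nra.
Qed.

Lemma le_deriv_left (I : set R) (f : R -> R) (t l c d : R) :
  has_deriv_in I (f : R -> R^o) t l -> 0 < d ->
  (forall h, 0 < h < d -> I (t - h) /\ f t - f (t - h) <= c * h) -> l <= c.
Proof.
move=> fl d0 fc; apply/ler_addgt0Pr => e e0.
have [d' d'0 dP] := has_deriv_in_real fl e0.
have [h [h0 hd hd']] := smaller_pos d0 d'0.
have [|Ih ch] := fc h; first by rewrite h0.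
have := dP (- h); rewrite normrN gtr0_norm// => /(_ hd' Ih).
rewrite ler_norml => /andP[_]; clear - ch h0; nra.
Qed.

(** A mean value inequality for derivatives relative to I, which may be one-sided at the ends. Real
    induction gives the rate delta - e, and the loss e is then sent to 0. *)
Lemma increment_ge (I : set R) (f : R -> R) (delta s t : R) : s <= t ->
  (forall r, s <= r <= t -> I r) ->
  (forall r, s <= r <= t ->
     exists2 d, has_deriv_in I (f : R -> R^o) r d & delta <= d) ->
  delta * (t - s) <= f t - f s.
Proof.
move=> st sI fd.
have key e : 0 < e -> (delta - e) * (t - s) <= f t - f s.
  move=> e0.
  apply: (@real_induction _ (fun r => (delta - e) * (r - s) <= f r - f s) s t).
  - by rewrite !subrr mulr0.
  - move=> r /andP[sr rt] Pr.
    have srt : s <= r <= t by rewrite sr ltW.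
    have {}Pr : (delta - e) * (r - s) <= f r - f s by apply: Pr; rewrite sr lexx.
    have [l fl dl] := fd r srt.
    have [d d0 dP] := deriv_ge_right fl dl e0.
    exists d => // r' /andP[rr' r'd] r't.
    have r'E : r + (r' - r) = r' by rewrite addrC subrK.
    have := dP (r' - r); rewrite r'E subr_ge0 ltrBlDl r'd (ltW rr').
    have Ir' : I r' by apply: sI; rewrite r't (le_trans sr (ltW rr')).
    by move=> /(_ isT Ir'); clear - Pr; lra.
  - move=> r /andP[sr rt] Pr.
    have srt : s <= r <= t by rewrite rt ltW.
    have [l fl dl] := fd r srt.
    have [d d0 dP] := deriv_ge_left fl dl e0.
    have sr0 : 0 < r - s by rewrite subr_gt0.
    have [h [h0 hd hs]] := smaller_pos d0 sr0.
    have sh : s <= r - h by rewrite lerBrDl -lerBrDr ltW.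
    have hr : r - h < r by rewrite ltrBlDr ltrDl.
    have shr : s <= r - h < r by rewrite sh hr.
    have := Pr _ shr; have := dP h; rewrite (ltW h0) hd => /(_ isT).
    have Ir' : I (r - h) by apply: sI; rewrite sh (le_trans (ltW hr)).
    by move=> /(_ Ir'); clear; lra.
  - by rewrite st lexx.
have [<-|st'] := eqVneq s t; first by rewrite !subrr mulr0.
have st0 : 0 < t - s by rewrite subr_gt0 lt_neqAle st'.
apply/ler_addgt0Pr => e e0.
have := key (e / (t - s)) (divr_gt0 e0 st0).
by rewrite mulrBl divfK ?gt_eqF// lerBlDr.
Qed.

(** Arithmetic of the first-order condition in t: p, q, r stand for the values of u at t, t - h and
    s, and the hypothesis says that moving t back to t - h does not lower Phi. *)
Lemma le_later_increment (p q r c e s t h : R) :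
  p - r - c * (t - s) + e * t <= q - r - c * (t - h - s) + e * (t - h) ->
  p - q <= (c - e) * h.
Proof. by lra. Qed.

(** Counterpart for moving s back to s - h: here p, q, r stand for the values of u at s - h, s and
    t. *)
Lemma ge_earlier_increment (p q r c e s t h : R) :
  r - q - c * (t - s) + e * t <= r - p - c * (t - (s - h)) + e * t ->
  c * h <= q - p.
Proof. by lra. Qed.

End TimeDerivative.

Lemma within_comp_continuous (X Y Z : topologicalType) (A : set X) (B : set Y)
    (h : X -> Y) (f : Y -> Z) : continuous h -> (forall x, A x -> B (h x)) ->
  {within B, continuous f} -> {within A, continuous (f \o h)}.
Proof.
move=> ch AB /subspace_continuousP cf; apply/subspace_continuousP => x Ax.
move=> W /(cf _ (AB x Ax)) Wx.
have Wx' : nbhs x [set y | B (h y) -> W (f (h y))] by exact: (ch x _ Wx).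
by apply: filterS Wx' => y /= hy Ay; apply/hy/AB.
Qed.

(** * Comparison of the flow at two times *)

Section Flow.
Context {R : realType} {n m1 : nat} {G : carnotGroup R n m1}.

Lemma smooth_fun_time_slice (Omega : set G) (I : set R) (u : G -> R -> R) t :
  smooth_fun_time Omega I u -> I t -> smooth_fun Omega (u ^~ t).
Proof.
move=> su It c ac.
exact: (smooth_on_slice (f := fun p => u (cbwd c p.1) p.2) It (su c ac)).
Qed.

(** Here f is smooth only inside Omega, yet the bound is uniform up to the boundary: around each
    point of the closure, convexity supplies a smooth extension w of u0 with speed bounded below,
    and f has the speed of w on the part inside Omega. Compactness makes the constant uniform. *)
Lemma initial_speed_ge (Omega : set G) (u0 f : G -> R) : open Omega ->
  compact (closure Omega) -> smooth_fun Omega f ->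
  (forall x, Omega x -> f x = u0 x) ->
  strictly_weakly_Hconvex (closure Omega) u0 ->
  exists2 c : R, 0 < c & forall x, Omega x -> c <= flow_speed f x.
Proof.
move=> oO cO sf fu0 conv.
move/compact_near_coveringP : cO => cov.
pose P (c : R) (y : G) := Omega y -> c <= flow_speed f y.
have : \forall c \near 0^'+, closure Omega `<=` P c.
  apply: cov => x Ox.
  have [W [w [oW Wx sw wE pw]]] := conv x Ox.
  have [c c0 cP] := flow_speed_lower_bound oW sw Wx pw.
  have nW : nbhs x W by exact: open_nbhs_nbhs.
  exists ([set y | W y /\ c <= flow_speed w y], [set e | e <= c]).
    by split; [exact: filterI nW cP|exact: nbhs_right_le].
  move=> [y e] /= [[Wy cy] ec] Oy.
  apply: (le_trans ec); suff -> : flow_speed f y = flow_speed w y by [].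
  apply: (@flow_speed_local _ _ _ _ (Omega `&` W)) => //; first exact: openI.
  by move=> z [Oz Wz]; rewrite fu0// wE//; exact: subset_closure.
move=> cnear.
have [c [c0 cP]] := filter_ex (filterI (nbhs_right_gt (0 : R)) cnear).
by exists c => // x Ox; apply: cP => //; exact: subset_closure.
Qed.

Lemma triangle_compact (b : R) :
  compact [set p : R * R | 0 <= p.1 /\ p.1 <= p.2 /\ p.2 <= b].
Proof.
have cI : compact (`[0, b] `*` `[0, b] : set (R * R)).
  by apply: compact_setX; exact: segment_compact.
apply: (@subclosed_compact _ _ (`[0, b] `*` `[0, b])) => //.
  have -> : [set p : R * R | 0 <= p.1 /\ p.1 <= p.2 /\ p.2 <= b] =
      (`[0, b] `*` `[0, b]) `&` (fun p => p.2 - p.1) @^-1` [set x | 0 <= x].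
    apply/seteqP; split => [[p q] /= [p0 [pq qb]]|[p q] /=].
      by rewrite !in_itv/= p0 qb subr_ge0 pq (le_trans pq qb) (le_trans p0 pq).
    rewrite !in_itv/= subr_ge0 => -[[/andP[p0 _] /andP[_ qb]] pq].
    by split.
  apply: closedI; first by apply: compact_closed => //; exact: norm_hausdorff.
  apply: closed_comp; last exact: closed_ge.
  move=> [p q] _; exact: (cvgB (@snd_cvg _ _ p q) (@fst_cvg _ _ p q)).
move=> [p q] /= [p0 [pq qb]].
by rewrite !in_itv/= p0 qb (le_trans pq qb) (le_trans p0 pq).
Qed.

Variables (Omega : set G) (T : \bar R) (delta : R) (u0 : G -> R).
Variables (g u : G -> R -> R).
Hypotheses (Omega_open : open Omega) (Omega_bounded : cc_bounded Omega).
Hypotheses (T_gt0 : (0%:E < T)%E) (delta_gt0 : 0 < delta).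
Hypothesis u_sol : smooth_flow_solution Omega T u0 g u.
Hypothesis g_t : forall x t, (closure Omega `\` Omega) x -> time_interval T t ->
  exists2 d : R, has_deriv_in (time_interval T) (g x : R -> R^o) t d & delta <= d.
Hypothesis u0_convex : strictly_weakly_Hconvex (closure Omega) u0.

Lemma time_interval_le r t : time_interval T t -> 0 <= r <= t -> time_interval T r.
Proof.
move=> [_ tT] /andP[r0 rt]; split => //.
by apply: le_lt_trans tT; rewrite lee_fin.
Qed.

Lemma slice_smooth t : time_interval T t -> smooth_fun Omega (u ^~ t).
Proof. by case: u_sol => su _ _ _ _; exact: smooth_fun_time_slice. Qed.

Lemma flow_equation x t : Omega x -> time_interval T t ->
  has_deriv_in (time_interval T) (u x : R -> R^o) t (flow_speed (u ^~ t) x).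
Proof. by case: u_sol => _ _ + _ _; exact. Qed.

Lemma boundary_increment x s t : (closure Omega `\` Omega) x ->
  0 <= s -> s <= t -> time_interval T t -> delta * (t - s) <= u x t - u x s.
Proof.
move=> bx s0 st Tt; case: u_sol => _ _ _ _ ug.
have sub r : s <= r <= t -> time_interval T r.
  by move=> /andP[sr rt]; apply: time_interval_le Tt _; rewrite rt (le_trans s0 sr).
rewrite !ug//; last by apply: sub; rewrite lexx.
by apply: (increment_ge st sub) => r /sub; exact: g_t.
Qed.

Lemma interior_increment : exists2 c : R, 0 < c &
  forall x s t, Omega x -> 0 <= s -> s <= t -> time_interval T t ->
    c * (t - s) <= u x t - u x s.
Proof.
have cO := cc_bounded_closure_compact Omega_bounded.
have T0 : time_interval T 0 by split.
have [c0 c0_gt0 c0P] : exists2 c : R, 0 < c &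
    forall x, Omega x -> c <= flow_speed (u ^~ 0) x.
  apply: initial_speed_ge u0_convex => //; first exact: slice_smooth.
  by case: u_sol => _ _ _ uu0 _ x Ox; apply: uu0; exact: subset_closure.
(* Below c0 for minima with s = 0, below delta for minima on the boundary. *)
have [c [c_gt0 cc0 cdelta]] := smaller_pos c0_gt0 delta_gt0.
exists c => // x1 s1 t1 Ox1 s1_ge0 st1 Tt1.
apply/ler_addgt0Pr => e' e'0.
(* Makes the penalty e t at most e' for t up to t1; the + 1 covers t1 = 0. *)
pose e := e' / (t1 + 1).
have t1_ge0 : 0 <= t1 by exact: le_trans st1.
have t11 : 0 < t1 + 1 by rewrite ltr_wpDl.
have e_gt0 : 0 < e by rewrite divr_gt0.
pose Phi (z : G * (R * R)) : R :=
  u z.1 z.2.2 - u z.1 z.2.1 - c * (z.2.2 - z.2.1) + e * z.2.2.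
pose K := closure Omega `*`
  [set p : R * R | 0 <= p.1 /\ p.1 <= p.2 /\ p.2 <= t1].
suff Phi_ge0 : forall z, K z -> 0 <= Phi z.
  have : 0 <= Phi (x1, (s1, t1)).
    by apply: Phi_ge0; split => //=; exact: subset_closure.
  have : e * t1 <= e'.
    by rewrite /e mulrAC ler_pdivrMr// ler_pM2l// lerDl.
  by rewrite /Phi/=; lra.
have KI x s t : K (x, (s, t)) -> [/\ closure Omega x, 0 <= s, s <= t, t <= t1
    & time_interval T s /\ time_interval T t].
  move=> [/= Ox [s0 [st tt1]]]; split => //; split; apply: time_interval_le Tt1 _.
    by rewrite s0 (le_trans st).
  by rewrite tt1 (le_trans s0).
have cK : compact K by apply: compact_setX => //; exact: triangle_compact.
have cPhi : {within K, continuous Phi}.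
  have cu : {within closure Omega `*` time_interval T,
      continuous (fun p : G * R => u p.1 p.2)} by case: u_sol.
  have c1 (z : G * (R * R)) : (fun z : G * (R * R) => z.1) @ z --> z.1.
    by case: z => x p; exact: fst_cvg.
  have c2 (z : G * (R * R)) : (fun z : G * (R * R) => z.2) @ z --> z.2.
    by case: z => x p; exact: snd_cvg.
  have c21 (z : G * (R * R)) : (fun z : G * (R * R) => z.2.1) @ z --> z.2.1.
    by case: z => x [s t]; exact: (cvg_comp _ _ (c2 (x, (s, t))) (@fst_cvg _ _ s t)).
  have c22 (z : G * (R * R)) : (fun z : G * (R * R) => z.2.2) @ z --> z.2.2.
    by case: z => x [s t]; exact: (cvg_comp _ _ (c2 (x, (s, t))) (@snd_cvg _ _ s t)).
  have ct : {within K, continuous (fun z : G * (R * R) => u z.1 z.2.2)}.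
    apply: (within_comp_continuous (h := fun z => (z.1, z.2.2)) _ _ cu).
      by move=> z; exact: (cvg_pair (c1 z) (c22 z)).
    by move=> [x [s t]] /KI[? _ _ _ [_ ?]].
  have cs : {within K, continuous (fun z : G * (R * R) => u z.1 z.2.1)}.
    apply: (within_comp_continuous (h := fun z => (z.1, z.2.1)) _ _ cu).
      by move=> z; exact: (cvg_pair (c1 z) (c21 z)).
    by move=> [x [s t]] /KI[? _ _ _ [? _]].
  have cl : {within K, continuous
      (fun z : G * (R * R) => - (c * (z.2.2 - z.2.1)) + e * z.2.2)}.
    apply: continuous_subspaceT => z; apply: cvgD.
      by apply: cvgN; apply: cvgM; [exact: cvg_cst|exact: (cvgB (c22 z) (c21 z))].
    by apply: cvgM; [exact: cvg_cst|exact: c22].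
  have -> : Phi = fun z => u z.1 z.2.2 - u z.1 z.2.1 +
      (- (c * (z.2.2 - z.2.1)) + e * z.2.2).
    by apply/funext => z; rewrite /Phi addrA.
  move=> z; exact: (cvgD (cvgB (ct z) (cs z)) (cl z)).
have K0 : K !=set0.
  by exists (x1, (s1, t1)); split => //=; exact: subset_closure.
have [[x [s t]] Kz minz] := compact_EVT_min K0 cK cPhi.
rewrite inE in Kz; have [Ox s_ge0 st tt1 [Ts Tt]] := KI _ _ _ Kz.
move=> z' Kz'; apply: (@le_trans _ _ (Phi (x, (s, t)))); last by apply: minz; rewrite inE.
have {}minz y r q : closure Omega y -> 0 <= r -> r <= q -> q <= t1 ->
    Phi (x, (s, t)) <= Phi (y, (r, q)).
  by move=> Oy r0 rq qt; apply: minz; rewrite inE; split.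
rewrite leNgt; apply/negP => Phi_lt0.
have t_ge0 : 0 <= t by exact: le_trans st.
(* On the diagonal s = t, Phi reduces to e t, which is nonnegative. *)
have {}st : s < t.
  rewrite lt_neqAle st andbT; apply: contraPneq Phi_lt0 => ->.
  by rewrite /Phi/= !subrr mulr0 subr0 add0r => /lt_geF; rewrite mulr_ge0// ltW.
have {}Ox : Omega x.
  apply: contrapT => nOx.
  have := boundary_increment (conj Ox nOx) s_ge0 (ltW st) Tt.
  move: Phi_lt0; rewrite /Phi/=.
  have : c * (t - s) <= delta * (t - s).
    by rewrite ler_pM2r ?subr_gt0// ltW.
  have : 0 <= e * t by rewrite mulr_ge0// ltW.
  by lra.
have ds_le_dt : flow_speed (u ^~ s) x <= flow_speed (u ^~ t) x.
  apply: (flow_speed_le_at_min Omega_open (slice_smooth Tt) (slice_smooth Ts) Ox).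
  have nO : nbhs x Omega by exact: open_nbhs_nbhs.
  apply: filterS nO => y Oy.
  have := minz y s t (subset_closure Oy) s_ge0 (ltW st) tt1.
  by rewrite /Phi/=; lra.
(* As t may equal t1, only earlier times t - h are tested; s < t leaves room for them. *)
have dt_le : flow_speed (u ^~ t) x <= c - e.
  have ts0 : 0 < t - s by rewrite subr_gt0.
  apply: (le_deriv_left (flow_equation Ox Tt) ts0) => h /andP[h0 hts].
  have sth : s <= t - h by rewrite lerBrDr -lerBrDl ltW.
  have tht : t - h <= t by rewrite lerBlDr lerDl ltW.
  split; first by apply: time_interval_le Tt _; rewrite tht (le_trans s_ge0).
  have := minz x s (t - h) (subset_closure Ox) s_ge0 sth (le_trans tht tt1).
  exact: le_later_increment.
have ds_ge : c <= flow_speed (u ^~ s) x.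
  (* At s = 0 the minimum can be tested only at later times, which bounds the speed from above; the
     lower bound is that of the initial datum. *)
  have [->|s0] := eqVneq s 0; first exact: le_trans (ltW cc0) (c0P x Ox).
  have {}s0 : 0 < s by rewrite lt_neqAle eq_sym s0.
  apply: (ge_deriv_left (flow_equation Ox Ts) s0) => h /andP[h0 hs].
  have sh : 0 <= s - h by rewrite subr_ge0 ltW.
  have shs : s - h <= s by rewrite lerBlDr lerDl ltW.
  split; first by apply: time_interval_le Ts _; rewrite shs sh.
  have := minz x (s - h) t (subset_closure Ox) sh (le_trans shs (ltW st)) tt1.
  exact: ge_earlier_increment.
by have := le_trans ds_ge (le_trans ds_le_dt dt_le); rewrite lerBrDr gerDl leNgt e_gt0.
Qed.

Lemma flow_Hconvex t : time_interval T t -> strictly_weakly_Hconvex Omega (u ^~ t).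
Proof.
move=> Tt x Ox; exists Omega, (u ^~ t); split => //; first exact: slice_smooth.
apply: flow_speed_gt0.
have [c c_gt0 cP] := interior_increment.
apply: (lt_le_trans c_gt0).
(* The speed at t is read off from forward differences, legitimate also at t = 0; d keeps t + h
   below T, which may be infinite. *)
have [d d0 dT] : exists2 d : R, 0 < d & ((t + d)%:E <= T)%E.
  case: Tt => _; case: (T) => [r|_|//].
    rewrite lte_fin => tr; exists (r - t); first by rewrite subr_gt0.
    by rewrite addrC subrK.
  by exists 1 => //; rewrite leey.
apply: (ge_deriv_right (flow_equation Ox Tt) d0) => h /andP[h0 hd].
have [t0 _] := Tt.
have Tth : time_interval T (t + h).
  split; first by rewrite addr_ge0// ltW.
  by apply: lt_le_trans dT; rewrite lte_fin ltrD2l.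
split => //.
have := cP x t (t + h) Ox t0 _ Tth; rewrite lerDl (ltW h0) => /(_ isT).
by rewrite [t + h - t]addrAC subrr add0r.
Qed.

End Flow.

Theorem theorem11 (R : realType) (n m1 : nat) (G : carnotGroup R n m1)
    (Omega : set G) (T : \bar R) (delta : R)
    (u0 : G -> R) (g u : G -> R -> R)
    (Omega_open : open Omega) (Omega_bounded : cc_bounded Omega)
    (T_gt0 : (0%:E < T)%E) (delta_gt0 : 0 < delta)
    (u_sol : smooth_flow_solution Omega T u0 g u)
    (g_t : forall x t, (closure Omega `\` Omega) x -> time_interval T t ->
       exists2 d : R, has_deriv_in (time_interval T) (g x : R -> R^o) t d
         & delta <= d)
    (u0_convex : strictly_weakly_Hconvex (closure Omega) u0) :
  forall t, time_interval T t -> strictly_weakly_Hconvex Omega (u ^~ t).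
Proof.
exact: (flow_Hconvex Omega_open Omega_bounded T_gt0 delta_gt0 u_sol g_t u0_convex).
Qed.
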